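(* There exists a function $c(k)=\exp(\mathcal{O}(k^2))$ such that, for every $k\ge 1$, there is a randomized online algorithm for the weighted $k$-server problem on uniform metrics which is $c(k)$-competitive, i.e. the problem admits an $\exp(\mathcal{O}(k^2))$-competitive randomized online algorithm.
   Context: Weighted $k$-server on a uniform metric: there is a set $M$ of points, where any two distinct points are at distance $1$. There are $k$ servers with non-negative real weights $w_1\le w_2\le\cdots\le w_k$ and given initial positions in $M$. Requests (points of $M$) arrive online one at a time; each request must be served, before the next one is revealed, by having some server located at the requested point (moving one server there if none is there already). Moving a server of weight $w$ from one point to a different point costs $w$. The goal is to minimize total cost. For a request sequence $\rho$, $\mathrm{OPT}(\rho)$ is the minimum cost of serving $\rho$ in hindsight, and $\mathrm{ALG}(\rho)$ is the expected cost of the randomized online algorithm on $\rho$ (against an oblivious adversary, i.e. $\rho$ is fixed in advance independently of the algorithm's random choices). An algorithm is $c$-competitive, where $c$ depends only on $k$, if there is a constant $c'$ (which may depend on the weights and the initial configuration but not on $\rho$) such that $\mathrm{ALG}(\rho)\le c\cdot\mathrm{OPT}(\rho)+c'$ for every finite request sequence $\rho$. *)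

(* Defs.v *)
From HB Require Import structures.
From mathcomp Require Import all_boot all_order all_algebra.
From mathcomp Require Import all_classical all_reals all_analysis measurable_realfun.

Set Implicit Arguments.
Unset Strict Implicit.
Unset Printing Implicit Defensive.

Import Order.TTheory GRing.Theory Num.Theory.
Import numFieldNormedType.Exports.

Local Open Scope classical_set_scope.
Local Open Scope ring_scope.

(* The set of points may be finite or infinite.  The uniform metric is not
   stored: distinct points are at distance 1, so a move of a server costs its
   weight times the boolean [x != y]. *)
Record instance (R : realType) (k : nat) := Instance {
  pts : eqType;
  weight : 'I_k -> R;
  init : {ffun 'I_k -> pts};
  weight_ge0 : forall i, 0 <= weight i;
  weight_sorted : forall i j : 'I_k, (i <= j)%N -> weight i <= weight j
}.

Section Server.
Variables (R : realType) (k : nat) (I : instance R k).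

Definition config := {ffun 'I_k -> pts I}.

Definition move_cost (p q : config) : R :=
  \sum_(j < k) weight I j * (p j != q j)%:R.

(* A schedule [s] lists the configurations over time: [s 0] is the initial one
   and [s i.+1] is the one in which the request number [i] (counted from 0) is
   served.  Any number of servers may move in a step. *)
Definition schedule_cost (n : nat) (s : nat -> config) : R :=
  \sum_(i < n) move_cost (s i) (s i.+1).

Definition serves (rho : seq (pts I)) (s : nat -> config) : Prop :=
  s 0 = init I /\
  forall i : 'I_(size rho), exists j : 'I_k, s i.+1 j = tnth (in_tuple rho) i.

(* The infimum is a minimum when [0 < k]: see [OPT_attained]. *)
Definition OPT (rho : seq (pts I)) : R :=
  inf [set schedule_cost (size rho) s | s in [set s | serves rho s]].

(* [run rho] is the configuration reached after serving [rho]; it depends only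
   on the requests revealed so far, which is what makes the algorithm online. *)
Record det_alg := DetAlg {
  run :> seq (pts I) -> config;
  run_nil : run [::] = init I;
  run_rcons : forall rho r, exists j : 'I_k, run (rcons rho r) j = r
}.

Definition det_cost (a : det_alg) (rho : seq (pts I)) : R :=
  schedule_cost (size rho) (fun i => a (take i rho)).

(* A random choice of a deterministic online algorithm.  The two measurability
   fields say that "server j is at x after rho" and "server j moves when r is
   requested after rho" are events; the second one does not follow from the
   first when the set of points is uncountable. *)
Record rand_alg := RandAlg {
  rdisp : measure_display;
  rspace : measurableType rdisp;
  rprob : probability rspace R;
  rchoice : rspace -> det_alg;
  rchoice_at : forall rho j x, measurable [set w | rchoice w rho j = x];
  rchoice_move : forall rho r j,
    measurable [set w | rchoice w (rcons rho r) j <> rchoice w rho j]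
}.
Arguments rchoice : clear implicits.

(* The request sequence is fixed before the expectation is taken, that is, the
   adversary is oblivious. *)
Definition ALG (A : rand_alg) (rho : seq (pts I)) : \bar R :=
  'E_(rprob A)[fun w => det_cost (rchoice A w) rho]%E.

Lemma schedule_cost_ge0 n s : 0 <= schedule_cost n s.
Proof.
apply: sumr_ge0 => i _; apply: sumr_ge0 => j _.
by rewrite mulr_ge0 ?(weight_ge0 I) ?ler0n.
Qed.

Lemma take_tnth (rho : seq (pts I)) (i : 'I_(size rho)) :
  take i.+1 rho = rcons (take i rho) (tnth (in_tuple rho) i).
Proof.
set r := tnth _ i; rewrite (take_nth r) //.
by congr rcons; rewrite {2}/r (tnth_nth r).
Qed.

Lemma det_alg_serves (a : det_alg) rho :
  serves rho (fun i => a (take i rho)).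
Proof.
split=> [|i]; first by rewrite take0 run_nil.
have [j ej] := run_rcons a (take i rho) (tnth (in_tuple rho) i).
by exists j; rewrite take_tnth.
Qed.

Lemma OPT_le rho s : serves rho s -> OPT rho <= schedule_cost (size rho) s.
Proof.
move=> hs; apply: ge_inf; last by exists s.
by exists 0 => _ [t _ <-]; exact: schedule_cost_ge0.
Qed.

Lemma OPT_attained rho : (0 < k)%N ->
  exists2 s, serves rho s & schedule_cost (size rho) s = OPT rho.
Proof.
move=> k0; set n := size rho.
pose cnt (s : nat -> config) (j : 'I_k) := (\sum_(i < n) (s i j != s i.+1 j))%N.
have cnt_lt s j : (cnt s j < n.+1)%N.
  rewrite ltnS -[X in (_ <= X)%N]card_ord -sum1_card.
  by apply: leq_sum => i _; exact: leq_b1.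
pose F (f : {ffun 'I_k -> 'I_n.+1}) : R := \sum_(j < k) weight I j * (f j)%:R.
pose fc s := [ffun j => Ordinal (cnt_lt s j)].
have FE s : schedule_cost n s = F (fc s).
  rewrite /schedule_cost /move_cost exchange_big; apply: eq_bigr => j _ /=.
  by rewrite ffunE /= natr_sum mulr_sumr.
pose P f := `[< exists2 s, serves rho s & fc s = f >].
have [s0 hs0] : exists s, serves rho s.
  exists (fun i => if i is i'.+1 then
    [ffun _ => nth (init I (Ordinal k0)) rho i'] else init I).
  split=> // i; exists (Ordinal k0).
  by rewrite ffunE (tnth_nth (init I (Ordinal k0))).
have Ps0 : P (fc s0) by apply/asboolP; exists s0.
case: (arg_minP F Ps0) => f /asboolP[s hs fs] fmin.
exists s => //; apply/eqP; rewrite eq_le OPT_le // andbT.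
apply: lb_le_inf; first by exists (schedule_cost n s0); exists s0.
move=> _ [t ht <-]; rewrite -/n !FE fs; apply: fmin.
by apply/asboolP; exists t.
Qed.

Lemma measurable_det_cost (A : rand_alg) rho :
  measurable_fun setT (fun w => det_cost (rchoice A w) rho).
Proof.
rewrite /det_cost /schedule_cost /move_cost.
apply: measurable_sum => i; apply: measurable_sum => j.
apply: measurable_funM => //.
set r := tnth (in_tuple rho) i.
rewrite (_ : (fun _ => _) = \1_[set w |
  rchoice A w (rcons (take i rho) r) j <> rchoice A w (take i rho) j]).
  apply: measurable_indic; exact: rchoice_move.
apply/funext => w; rewrite indicE take_tnth -/r.
congr (nat_of_bool _)%:R; apply/idP/idP.
  by move=> /eqP h; rewrite inE /= => e; apply: h.
by rewrite inE /= => h; apply/eqP => e; apply: h.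
Qed.

End Server.
Arguments rchoice {R k I} _ _.

(* The algorithm is given the instance (points, weights, initial positions) in
   advance; the additive constant may depend on the instance. *)
Definition competitive (R : realType) (k : nat)
    (A : forall I : instance R k, rand_alg I) (c : R) : Prop :=
  forall I : instance R k, exists c' : R, forall rho : seq (pts I),
    (ALG (A I) rho <= (c * OPT rho + c')%:E)%E.

(* Main.v *)
(* Servers are numbered by levels 0, ..., k-1 in order of weight.  If some weight
   is zero, the lightest server serves everything for free; otherwise let m l be
   about w (l+1) / w l.  Every request string is cut greedily into level-l
   phases, in each of which servers 0, ..., l must pay a constant fraction
   2^-l of w l.  A level-(l+1) phase opens with m l phases of level l.  If server
   l+1 stays put during the phase at a point from which the lighter servers pay
   little, then that point belongs to a set of at most 2^(2^O(l)) candidates,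
   which is determined by the opening of the phase.  The algorithm orders the
   candidates at random and keeps server l+1 on the first one that is still
   alive, running the level-l algorithm on the requests to the other points.
   Candidates die at times that do not depend on the random order, so the
   expected number of candidates visited is harmonic, i.e. 2^O(l): passing from
   level l to level l+1 costs a factor 2^O(l), and the product over all levels is
   2^O(k^2).

   For the bound on the number of candidates, normalized lower bounds on the cost
   are attached to the nested phases.  Making a candidate x free decreases the
   bound of the opening, hence that of many of its phases.  From a random phase
   one can guess recursively an element of any set whose removal decreases the
   bound; at each level either this guess or a second one, made after the first
   one has been granted for free, hits x.  So x is guessed with probability
   2^-(2^O(l)), which bounds the number of such x. *)
From HB Require Import structures.
Require Import Defs.
From mathcomp Require Import all_boot all_order all_algebra all_fingroup.
From mathcomp Require Import all_classical all_reals all_analysis.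
From mathcomp Require Import ring lra zify.
Import Order.TTheory GRing.Theory Num.Theory.
Import numFieldNormedType.Exports.
Local Open Scope ring_scope.

Set Implicit Arguments.
Unset Strict Implicit.
Unset Printing Implicit Defensive.

(** * Phases and their lower bounds *)

Section Phases.
Variables (T : eqType) (comp : pred (seq T)).

(* A completed phase remains the current one until the next request arrives. *)
Definition phase_step (pc : seq (seq T) * seq T) (r : T) :=
  let c := if comp pc.2 then [:: r] else rcons pc.2 r in
  (if comp c then rcons pc.1 c else pc.1, c).

Definition scan (s : seq T) := foldl phase_step ([::], [::]) s.
Definition phases s := (scan s).1.
Definition current s := (scan s).2.

Lemma current_rcons s r :
  current (rcons s r) = if comp (current s) then [:: r] else rcons (current s) r.
Proof. by rewrite /current /scan foldl_rcons. Qed.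

Lemma phases_rcons s r : phases (rcons s r) =
  if comp (current (rcons s r)) then rcons (phases s) (current (rcons s r))
  else phases s.
Proof. by rewrite current_rcons /phases /scan foldl_rcons. Qed.

Lemma all_comp_phases s : all comp (phases s).
Proof.
elim/last_ind: s => [//|s r IH]; rewrite phases_rcons.
by case: ifP => [h|//]; rewrite all_rcons h.
Qed.

Lemma cat_phases s : exists rest, s = flatten (phases s) ++ rest.
Proof.
(* A complete current phase is already listed in [phases s]; only an unfinished one remains. *)
suff h : s = flatten (phases s) ++ (if comp (current s) then [::] else current s).
  by eexists; exact: h.
elim/last_ind: s => [|s r IH]; first by rewrite /current /=; case: ifP.
rewrite phases_rcons; case: ifP => hc; last first.
  move: hc; rewrite current_rcons; case: ifP IH => _ IH hc.
    by rewrite {1}IH cats0 cats1.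
  by rewrite {1}IH rcons_cat.
rewrite cats0 flatten_rcons current_rcons; move: hc; rewrite current_rcons.
case: ifP IH => _ IH hc; first by rewrite {1}IH cats0 cats1.
by rewrite {1}IH rcons_cat.
Qed.

Lemma mem_phases s v x : v \in phases s -> x \in v -> x \in s.
Proof.
move=> hv hx; have [rest ->] := cat_phases s.
by rewrite mem_cat; apply/orP; left; apply/flattenP; exists v.
Qed.

Lemma size_phases_rcons s r :
  (size (phases s) <= size (phases (rcons s r)) <= (size (phases s)).+1)%N.
Proof. by rewrite phases_rcons; case: ifP; rewrite ?size_rcons !leqnn ?leqnSn. Qed.

Lemma take_phases_rcons n s r : (n <= size (phases s))%N ->
  take n (phases (rcons s r)) = take n (phases s).
Proof.
by move=> h; rewrite phases_rcons; case: ifP => // _; rewrite -cats1 takel_cat.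
Qed.

(** Greedy cutting makes every phase fresh: before its last request it is incomplete, so some
    position of the heaviest server is still cheap. *)
Definition fresh (s : seq T) := forall i, (i < size s)%N -> ~~ comp (take i s).

Lemma fresh_rcons s r : fresh s -> ~~ comp s -> fresh (rcons s r).
Proof.
move=> fs cs i; rewrite size_rcons ltnS leq_eqVlt => /orP[/eqP->|hi].
  by rewrite -cats1 takel_cat // take_size.
by rewrite -cats1 takel_cat; [exact: fs|exact: ltnW].
Qed.

Hypothesis comp_nil : ~~ comp [::].

Lemma fresh_phases s :
  (forall v, v \in phases s -> fresh v) /\ fresh (current s).
Proof.
elim/last_ind: s => [|s r [IHp IHc]]; first by split=> // v; rewrite in_nil.
have hc : fresh (current (rcons s r)).
  rewrite current_rcons; case: ifP => [_|/negbT hn]; last exact: fresh_rcons.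
  by move=> [|i] //= _.
split=> // v; rewrite phases_rcons; case: ifP => _; last exact: IHp.
by rewrite mem_rcons inE => /orP[/eqP->|/IHp].
Qed.

Lemma last_current x0 s : last x0 (current s) = last x0 s.
Proof.
case/lastP: s => [//|s r]; rewrite current_rcons.
by case: ifP; rewrite /= !last_rcons.
Qed.

End Phases.

Section Remove.
Variable T : eqType.

Definition remove (q : option T) (s : seq T) := [seq x <- s | Some x != q].

Lemma remove_none s : remove None s = s.
Proof. by rewrite /remove; elim: s => //= x s ->. Qed.

Lemma remove_rcons q s r : remove q (rcons s r) =
  if Some r != q then rcons (remove q s) r else remove q s.
Proof. by rewrite /remove filter_rcons. Qed.

Lemma mem_remove q s x : (x \in remove q s) = (Some x != q) && (x \in s).
Proof. by rewrite mem_filter. Qed.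

Lemma remove_notin x s : x \notin s -> remove (Some x) s = s.
Proof.
move=> h; apply/all_filterP/allP => y hy; apply/eqP => -[e].
by rewrite -e hy in h.
Qed.

End Remove.

Section Tree.
Variables (R : realFieldType) (T : eqType) (m : nat -> nat).
Hypothesis m_gt0 : forall l, (0 < m l)%N.

(* One more server is placed: points outside u are all useless, and they are
   represented by the default value f u A. *)
Definition best (f : seq T -> seq T -> R) u A :=
  \big[Num.min/f u A]_(x <- u) f u (x :: A).

Definition beta l : R := 2^-1 ^+ l.

(* The factor is 1/n even when S has fewer than n elements. *)
Definition average (f : seq T -> seq T -> R) n (S : seq (seq T)) A :=
  n%:R^-1 * \sum_(v <- S) best f v A.

(* w l * bound l u A is at most the cost of servers 0, ..., l-1 for serving u when
   the requests to the points of A are free; A stands for the positions of the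
   heavier servers.  Besides the phases of u itself (q = None), one may use those
   of u deprived of the requests to a single point of A.  Because of these the
   bound need not be monotone in A. *)
Fixpoint bound l : seq T -> seq T -> R :=
  if l is l'.+1 then fun u A =>
    \big[Num.max/0]_(q <- None :: map Some A)
      average (bound l') (m l')
        (take (m l') (phases (fun v => beta l' <= best (bound l') v [::])
                             (remove q u))) A
  else fun u A => (has (fun x => x \notin A) u)%:R.

Lemma betaE l : beta l = 2^-1 ^+ l.
Proof. by []. Qed.

(* A phase is complete when no position of server l makes it cheap; best includes
   positions outside the phase. *)
Definition complete l u := beta l <= best (bound l) u [::].
Lemma incompleteE l u : ~~ complete l u = (best (bound l) u [::] < beta l).
Proof. by rewrite /complete ltNge. Qed.

Definition level_phases l := phases (complete l).
Definition level_average l u A := average (bound l) (m l) (take (m l) (level_phases l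
  u)) A.

Lemma boundS l u A : bound l.+1 u A =
  \big[Num.max/0]_(q <- None :: map Some A) level_average l (remove q u) A.
Proof. by []. Qed.

Lemma bigmin_ex (I : eqType) (r : seq I) (a : R) (F : I -> R) :
  \big[Num.min/a]_(i <- r) F i = a \/
  exists2 i, i \in r & \big[Num.min/a]_(i <- r) F i = F i.
Proof.
elim: r => [|i r IH]; first by left; rewrite big_nil.
rewrite big_cons; case: leP => _; first by right; exists i; rewrite ?mem_head.
case: IH => [->|[j jr ->]]; [by left|right].
by exists j; rewrite // inE jr orbT.
Qed.

Lemma bigmax_ex (I : eqType) (r : seq I) (a : R) (F : I -> R) :
  \big[Num.max/a]_(i <- r) F i = a \/
  exists2 i, i \in r & \big[Num.max/a]_(i <- r) F i = F i.
Proof.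
elim: r => [|i r IH]; first by left; rewrite big_nil.
rewrite big_cons; case: leP => _; last by right; exists i; rewrite ?mem_head.
case: IH => [->|[j jr ->]]; [by left|right].
by exists j; rewrite // inE jr orbT.
Qed.

Lemma best_le f u A : best f u A <= f u A.
Proof. exact: bigmin_le_id. Qed.

Lemma best_le_mem f u A x : x \in u -> best f u A <= f u (x :: A).
Proof. by move=> h; apply: ge_bigmin_seq. Qed.

Lemma best_ex f u A : best f u A = f u A \/
  exists2 x, x \in u & best f u A = f u (x :: A).
Proof. exact: bigmin_ex. Qed.

Lemma average_le1 f n S A : (forall v, best f v A <= 1) -> (size S <= n)%N ->
  average f n S A <= 1.
Proof.
move=> h; case: n => [|n] hn; first by rewrite /average invr0 mul0r.
rewrite /average ler_pdivrMl ?ltr0n // mulr1.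
apply: le_trans (ler_sum _ (fun v _ => h v)) _.
by rewrite big_const_seq count_predT iter_addr addr0 ler_nat.
Qed.

Lemma bound_ge0 l u A : 0 <= bound l u A.
Proof.
case: l => [|l]; first exact: ler0n.
by rewrite boundS; exact: bigmax_ge_id.
Qed.

Lemma bound_le1 l u A : bound l u A <= 1.
Proof.
elim: l u A => [|l IH] u A; first by rewrite /= lern1 leq_b1.
rewrite boundS; apply: bigmax_le => // q _.
apply: average_le1; first by move=> v; apply: le_trans (best_le _ _ _) (IH _ _).
by rewrite size_take; case: ltnP.
Qed.

Lemma best_ge0 l u A : 0 <= best (bound l) u A.
Proof. by case: (best_ex (bound l) u A) => [->|[x _ ->]]; exact: bound_ge0. Qed.

Lemma best_le1 l u A : best (bound l) u A <= 1.
Proof. exact: le_trans (best_le _ _ _) (bound_le1 _ _ _). Qed.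

Lemma avg_le_bound l u A q : q \in None :: map Some A ->
  level_average l (remove q u) A <= bound l.+1 u A.
Proof. by move=> h; rewrite boundS;
  apply: (@bigmax_sup_seq _ _ _ _ _ q xpredT _ (fun q => level_average l (remove q u) A)
    h). Qed.

Lemma avg0_le_bound l u A : level_average l u A <= bound l.+1 u A.
Proof. by rewrite -{1}(remove_none u) avg_le_bound ?mem_head. Qed.

Lemma avg_ge0 l u A : 0 <= level_average l u A.
Proof. by rewrite mulr_ge0 ?invr_ge0 ?ler0n// sumr_ge0// => v _; exact: best_ge0. Qed.

Lemma bound_ex l u A : exists2 q, q \in None :: map Some A &
  bound l.+1 u A = level_average l (remove q u) A.
Proof.
have [e|[q hq e]] :=
  bigmax_ex (None :: map Some A) 0 (fun q => level_average l (remove q u) A);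
    last by exists q.
exists None; rewrite ?mem_head // remove_none; apply/eqP.
by rewrite eq_le {1}boundS e avg_ge0 /= avg0_le_bound.
Qed.

Lemma best_eq l u A A' :
  (forall A A', {in u, A =i A'} -> bound l u A = bound l u A') ->
  {in u, A =i A'} -> best (bound l) u A = best (bound l) u A'.
Proof.
move=> h e; rewrite /best (h _ _ e); apply: eq_bigr => x _; apply: h => y hy.
by rewrite !inE e.
Qed.

Lemma bound_eq l u A A' : {in u, A =i A'} -> bound l u A = bound l u A'.
Proof.
elim: l u A A' => [|l IH] u A A' e /=.
  by congr (nat_of_bool _)%:R; apply: eq_in_has => x hx; rewrite e.
have avg_eq v : {subset v <= u} -> forall A A', {in u, A =i A'} ->
    level_average l v A = level_average l v A'.
  move=> vu B B' eB; congr (_ * _); apply: eq_big_seq => z hz.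
  apply: best_eq => [C C'|x hx]; first exact: IH.
  by apply/eB/vu; apply: mem_phases hx; apply: mem_take hz.
suff le B B' : {in u, B =i B'} -> bound l.+1 u B <= bound l.+1 u B'.
  by apply/eqP; rewrite eq_le !le // => x hx; rewrite e.
move=> eB; have [q hq ->] := bound_ex l u B.
(* The maximizing [q] must be admissible for [B'] too. A point outside [u] is replaced by [None],
   since removing it changes nothing. *)
have [hu|hu] := boolP (q \in map Some u); last first.
  rewrite (_ : remove q u = u) ?(avg_eq _ _ _ _ eB) ?avg0_le_bound //.
  case: q hu {hq} => [x|] hu; last exact: remove_none.
  by rewrite remove_notin // -(mem_map Some_inj).
rewrite (avg_eq _ _ _ _ eB) => [|x]; last by rewrite mem_remove => /andP[].
apply: avg_le_bound; move: hq; rewrite !inE; case: q hu => //= x.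
by rewrite !(mem_map Some_inj) => hu; rewrite eB.
Qed.

Lemma bound_notin l u A x : x \notin u -> bound l u (x :: A) = bound l u A.
Proof.
move=> hx; apply: bound_eq => y hy; rewrite inE.
by case: eqP => // e; rewrite -e hy in hx.
Qed.

(** So [best] is a minimum over all points of the space, although it ranges over [u] only. *)
Lemma best_le_cons l u A x : best (bound l) u A <= bound l u (x :: A).
Proof.
have [/best_le_mem->//|hx] := boolP (x \in u).
by rewrite (bound_notin _ _ hx) best_le.
Qed.

Lemma best_bound_notin l u A x : x \notin u ->
  best (bound l) u (x :: A) = best (bound l) u A.
Proof.
move=> hx; apply: best_eq => [B B'|y hy]; first exact: bound_eq.
by rewrite inE; case: eqP => // e; rewrite -e hy in hx.
Qed.

Lemma bound_nil l A : bound l [::] A = 0.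
Proof.
case: l => [//|l]; have [q _ ->] := bound_ex l [::] A.
by rewrite /level_average /average big_nil mulr0.
Qed.

Lemma beta_gt0 l : 0 < beta l.
Proof. by rewrite exprn_gt0 // invr_gt0. Qed.

Lemma beta_half l : beta l = 2 * beta l.+1.
Proof. by rewrite /beta exprS mulrA divff ?mul1r ?pnatr_eq0. Qed.

Lemma betaS_lt l : beta l.+1 < beta l.
Proof. by have := beta_gt0 l.+1; rewrite (beta_half l); lra. Qed.

Lemma complete_nil l : ~~ complete l [::].
Proof. by rewrite /complete /best big_nil bound_nil -ltNge beta_gt0. Qed.

Lemma avg_rcons l u r A : level_average l u A <= level_average l (rcons u r) A.
Proof.
rewrite /level_average /average ler_wpM2l ?invr_ge0 ?ler0n // /level_phases phases_rcons.
case: ifP => // _; rewrite -cats1 take_cat; case: ltnP => // h.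
by rewrite take_oversize // big_cat lerDl sumr_ge0 // => v _; exact: best_ge0.
Qed.

Lemma bound_rcons l u r A : bound l u A <= bound l (rcons u r) A.
Proof.
case: l => [|l].
  by rewrite /= ler_nat has_rcons; case: (has _ u); rewrite ?orbT ?leq_b1.
have [q hq ->] := bound_ex l u A.
apply: le_trans (avg_le_bound l _ hq); rewrite remove_rcons.
by case: ifP => // _; exact: avg_rcons.
Qed.

Lemma average_ge l n S A c : 0 <= c -> (forall v, v \in S -> c <= best (bound l) v A) ->
  (0 < n)%N -> (n <= size S)%N -> c <= average (bound l) n S A.
Proof.
move=> c0 h n0 hn; rewrite /average ler_pdivlMl ?ltr0n //.
apply: le_trans (_ : \sum_(v <- S) c <= _); last first.
  by rewrite big_seq [leRHS]big_seq; apply: ler_sum.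
rewrite big_const_seq count_predT iter_addr addr0 -[leRHS]mulr_natl ler_wpM2r //.
by rewrite ler_nat.
Qed.

(** The phases of a full opening are complete, so each contributes at least [beta l], twice the
    threshold [beta l.+1] below which a candidate lives. *)
Lemma avg_ready l u : (m l <= size (level_phases l u))%N -> beta l <= level_average l u
  [::].
Proof.
move=> h; apply: average_ge; rewrite ?(ltW (beta_gt0 _)) ?size_takel //.
by move=> v /mem_take hv; have /allP := all_comp_phases (complete l) u; apply.
Qed.

(* While x is alive, the level-l algorithm run without the requests to x is in its
   first m l phases. *)
Lemma ready_remove l u x : bound l.+1 u [:: x] < beta l.+1 ->
  (size (level_phases l (remove (Some x) u)) < m l)%N.
Proof.
apply: contraTT; rewrite -leqNgt -leNgt => h.
apply: le_trans (ltW (betaS_lt l)) _.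
apply: le_trans (avg_le_bound l _ (_ : Some x \in _)); last first.
  by rewrite !inE eqxx.
apply: le_trans (avg_ready h) _; rewrite le_eqVlt; apply/orP; left; apply/eqP.
congr (_ * _); apply: eq_big_seq => v /mem_take hv.
rewrite best_bound_notin //; apply/negP => /(mem_phases hv).
by rewrite mem_remove eqxx.
Qed.

End Tree.
Arguments bound_ge0 {R T m} l u A.
Arguments bound_le1 {R T m} l u A.
Arguments best_ge0 {R T m} l u A.
Arguments best_le1 {R T m} l u A.
Arguments avg_ge0 {R T m} l u A.
Arguments avg0_le_bound {R T m} l u A.
Arguments bound_ex {R T m} l u A.
Arguments bound_rcons {R T m} l u r A.
Arguments beta_gt0 {R} l.
Arguments beta_half {R} l.
Arguments betaS_lt {R} l.

(** * Few candidates *)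

Section Mass.
Variables (R : realFieldType) (T : eqType).
Implicit Types (D : seq (R * T)) (P : pred T).

(* Finitely supported measures on T are lists of weighted points. *)
Definition mass D P : R := \sum_(d <- D | P d.2) d.1.
Definition scale (c : R) D : seq (R * T) := [seq (c * d.1, d.2) | d <- D].
Definition subprob D := all (fun d => 0 <= d.1) D && (mass D xpredT <= 1).

Lemma mass_cat D D' P : mass (D ++ D') P = mass D P + mass D' P.
Proof. exact: big_cat. Qed.

Lemma mass_scale c D P : mass (scale c D) P = c * mass D P.
Proof. by rewrite /mass big_map mulr_sumr. Qed.

Lemma mass_flatten (I : Type) (r : seq I) (F : I -> seq (R * T)) P :
  mass (flatten [seq F i | i <- r]) P = \sum_(i <- r) mass (F i) P.
Proof. by rewrite /mass big_flatten big_map. Qed.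

Lemma mass_ge0 D P : subprob D -> 0 <= mass D P.
Proof.
move=> /andP[/allP h _]; rewrite /mass big_seq_cond sumr_ge0 // => d /andP[hd _].
exact: h.
Qed.

Lemma all_scale c D : 0 <= c -> all (fun d => 0 <= d.1) D ->
  all (fun d => 0 <= d.1) (scale c D).
Proof. by move=> c0 h; rewrite all_map; apply: sub_all h => d h; apply: mulr_ge0. Qed.

(** The events of hitting distinct points are disjoint. *)
Lemma count_mass D (s : seq T) c : subprob D -> uniq s ->
  (forall x, x \in s -> c <= mass D (pred1 x)) -> (size s)%:R * c <= 1.
Proof.
move=> /andP[/allP D0 D1] us h; apply: le_trans D1.
rewrite mulr_natl -[_ *+ _]addr0 -iter_addr -count_predT -big_const_seq.
apply: le_trans (_ : \sum_(x <- s) mass D (pred1 x) <= _).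
  by rewrite big_seq [leRHS]big_seq; apply: ler_sum.
rewrite /mass (exchange_big_dep predT) //= big_seq [leRHS]big_seq.
apply: ler_sum => d hd; rewrite big_const_seq iter_addr addr0.
rewrite (eq_count (_ : _ =1 pred1 d.2)) => [|x]; last by rewrite /= eq_sym.
rewrite count_uniq_mem //; case: (_ \in _); rewrite ?mulr1n ?mulr0n //; exact: D0.
Qed.

End Mass.

Section Guess.
Variables (R : realFieldType) (T : eqType) (m : nat -> nat).
Hypothesis m_gt0 : forall l, (0 < m l)%N.
Local Notation bound := (@bound R T m).
Local Notation beta := (@beta R).
Local Notation best_le1 := (@best_le1 R T m).
Local Notation best_ge0 := (@best_ge0 R T m).

(* chance l g is the probability with which an element of B is guessed when making
   B free decreases a level-l bound by g: the gap is halved because only phases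
   with half of the average decrease are used, and two guesses are needed. *)
Fixpoint chance l (g : R) : R :=
  if l is l'.+1 then g / 4 * chance l' (g / 2) ^+ 2 else 1.

Lemma chance_bnd l g : 0 <= g <= 1 -> 0 <= chance l g <= 1.
Proof.
elim: l g => [|l IH] g hg /=; first by rewrite ler01 lexx.
have := IH (g / 2); set c := chance l _ => hc.
have {}hc : 0 <= c <= 1 by apply: hc; lra.
by rewrite expr2; apply/andP; split; nra.
Qed.

(** The measure is chosen before [B]: a single [D] must hit every set that lowers the bound by [g]
    when made free. Applied to singletons, this becomes a counting argument. *)
Definition guesses l (D : seq (R * T)) (u A : seq T) := subprob D /\
  forall (B : seq T) (g : R), 0 < g -> g <= bound l u A - bound l u (B ++ A) ->
    chance l g <= mass D (mem B).

Lemma guess_best l v A : (forall u A, exists D, guesses l D u A) ->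
  exists D : seq (R * T), subprob D /\ forall (B : seq T) (g : R), 0 < g ->
    g <= best (bound l) v A - best (bound l) v (B ++ A) ->
    chance l g ^+ 2 / 2 <= mass D (mem B).
Proof.
move=> H; have [D0 [sD0 hD0]] := H v A.
(* With probability 1/2 the guess for A is returned, otherwise it is taken as the
   position x of the additional server and the guess for x :: A is returned. *)
have /choice[F hF] : forall x, exists D, guesses l D v (x :: A) by move=> x; exact: H.
pose G := flatten [seq scale d.1 (F d.2) | d <- D0].
have mG P : mass G P = \sum_(d <- D0) d.1 * mass (F d.2) P.
  by rewrite mass_flatten; apply: eq_bigr => d _; rewrite mass_scale.
have /andP[/allP D0p D0t] := sD0.
exists (scale 2^-1 (D0 ++ G)).
have mE P : mass (scale 2^-1 (D0 ++ G)) P = (mass D0 P + mass G P) / 2.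
  by rewrite mass_scale mass_cat mulrC.
have G0 : all (fun d => 0 <= d.1) G.
  apply/allP => e /flattenP[_ /mapP[d hd ->] he].
  have /andP[h _] := (hF d.2).1.
  exact: (allP (all_scale (D0p _ hd) h) _ he).
split.
  apply/andP; split; first by rewrite all_scale ?invr_ge0 // all_cat G0; apply/andP;
    split => //; apply/allP.
  have : mass G xpredT <= 1.
    rewrite mG; apply: le_trans D0t; rewrite /mass big_seq [leRHS]big_seq.
    apply: ler_sum => d hd; rewrite ler_piMr ?D0p //.
    by have /andP[_] := (hF d.2).1.
  by rewrite mE; move: D0t; lra.
move=> B g g0 hg.
have g1 : g <= 1.
  by have := best_le1 l v A; have := best_ge0 l v (B ++ A); move: hg; lra.
have := @chance_bnd l g; have -> : 0 <= g <= 1 by rewrite ltW.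
set c := chance l g => /(_ isT) c01.
have MB0 : 0 <= mass D0 (mem B) by exact: mass_ge0.
have MG0 : 0 <= mass G (mem B).
  by rewrite mG big_seq sumr_ge0 // => d hd;
    rewrite mulr_ge0 ?D0p // mass_ge0 // (hF _).1.
suff : c ^+ 2 <= mass D0 (mem B) + mass G (mem B) by rewrite mE; lra.
have [e|[x hx e]] := best_ex (bound l) v (B ++ A).
  have : c <= mass D0 (mem B).
    apply: hD0 => //; apply: le_trans hg _; rewrite e.
    by rewrite lerB // best_le.
  by rewrite expr2; nra.
(* The minimum for [B ++ A] is at a point [x] of [v]. Freeing [x :: B] lowers the bound by [g], so
   the first guess hits [B] or [x], with masses p + q >= c. After [x], the second guess hits [B]
   with mass at least c, which gives p + q c >= c ^ 2 in total. *)
have hc : c <= mass D0 (mem (x :: B)).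
  apply: hD0 => //; apply: le_trans hg _; rewrite e.
  by rewrite lerB // best_le.
have {}hc : c <= mass D0 (mem B) + mass D0 (pred1 x).
  apply: le_trans hc _; rewrite /mass big_mkcond [\sum_(d <- D0 | _ B _) _]big_mkcond.
  rewrite [\sum_(d <- D0 | pred1 _ _) _]big_mkcond -big_split /=.
  rewrite big_seq [leRHS]big_seq; apply: ler_sum => d /D0p d0.
  rewrite inE -[mem_seq B d.2]/(d.2 \in B).
  by case: (d.2 == x); case: (d.2 \in B); rewrite /= ?addr0 ?add0r // lerDl.
have hx2 : c <= mass (F x) (mem B).
  apply: (proj2 (hF x)) => //; apply: le_trans hg _; rewrite e.
  rewrite lerB ?best_le_mem // (_ : bound l v (x :: B ++ A) = bound l v (B ++ x :: A)) //.
  by apply: bound_eq => y _; rewrite !(inE, mem_cat) orbCA.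
have : mass D0 (pred1 x) * c <= mass G (mem B).
  rewrite mG /mass mulr_suml [leLHS]big_mkcond big_seq [leRHS]big_seq.
  apply: ler_sum => d hd; rewrite /=; case: (eqVneq d.2 x) => [->|_].
    by rewrite ler_wpM2l ?D0p.
  by rewrite mulr_ge0 ?D0p // mass_ge0 // (hF _).1.
by rewrite expr2; nra.
Qed.

Lemma guess_average l n S A : (forall u A, exists D, guesses l D u A) ->
  (0 < n)%N -> (size S <= n)%N ->
  exists D : seq (R * T), subprob D /\ forall (B : seq T) (g : R), 0 < g ->
    g <= average (bound l) n S A - average (bound l) n S (B ++ A) ->
    chance l.+1 g <= mass D (mem B).
Proof.
move=> H n0 hn.
have /choice[F hF] := fun v => guess_best v A H.
(* Each element of [S] is drawn with probability 1/n, then [guess_best] is applied to it. *)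
exists (scale n%:R^-1 (flatten [seq F v | v <- S])); split.
  apply/andP; split.
    rewrite all_scale ?invr_ge0 //; apply/allP => d /flattenP[_ /mapP[v _ ->]].
    by have /andP[/allP h _] := (hF v).1; apply: h.
  rewrite mass_scale mass_flatten ler_pdivrMl ?ltr0n // mulr1.
  apply: le_trans (ler_sum _ (_ : forall v, true -> _ <= 1)) _ => [v _|].
    by have /andP[] := (hF v).1.
  by rewrite big_const_seq count_predT iter_addr addr0 ler_nat.
move=> B g g0; rewrite /average -mulrBr -sumrB ler_pdivlMl ?ltr0n // => hg.
rewrite mass_scale mass_flatten ler_pdivlMl ?ltr0n //=.
have g1 : g <= 1.
  rewrite -(ler_pM2l (_ : 0 < n%:R)) ?ltr0n //; apply: le_trans hg _.
  apply: le_trans (ler_sum _ (_ : forall v, true -> _ <= 1)) _ => [v _|].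
    by have := best_le1 l v A; have := best_ge0 l v (B ++ A); lra.
  by rewrite mulr1 big_const_seq count_predT iter_addr addr0 ler_nat.
set c := chance l (g / 2).
have c01 : 0 <= c <= 1 by apply: chance_bnd; lra.
(* Pointwise the chance of success for v dominates a linear function of the
   decrease of v. *)
apply: le_trans (_ : \sum_(v <- S) (c ^+ 2 / 2) *
  (best (bound l) v A - best (bound l) v (B ++ A) - g / 2) <= _).
  rewrite -mulr_sumr sumrB big_const_seq count_predT iter_addr addr0.
  set s := \sum_(v <- S) _ in hg *.
  have : g / 2 *+ size S <= n%:R * (g / 2).
    rewrite -[_ *+ _]mulr_natl ler_wpM2r ?ler_nat //; lra.
  have : 0 <= c ^+ 2 by rewrite sqr_ge0.
  by set c2 := c ^+ 2; set t := _ *+ _; nra.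
apply: ler_sum => v _; set d := _ - _ - _.
have d1 : d <= 1 by have := best_le1 l v A; have := best_ge0 l v (B ++ A); rewrite /d;
  lra.
have c20 : 0 <= c ^+ 2 by rewrite sqr_ge0.
have [hd|hd] := leP 0 d.
  apply: le_trans (_ : c ^+ 2 / 2 <= _); first by nra.
  by apply: (proj2 (hF v)); [lra|move: hd; rewrite /d; lra].
have := mass_ge0 (mem B) (hF v).1; nra.
Qed.

Lemma guess l u A : exists D, guesses l D u A.
Proof.
elim: l u A => [|l IH] u A.
  (* At level 0 the bound drops only if [B] contains every point of [u] outside [A], so any one of
     them is a sure guess. *)
  case E : [seq x <- u | x \notin A] => [|x r].
    exists [::]; split; first by rewrite /subprob /mass big_nil ler01.
    move=> B g g0; rewrite /= has_filter E /= => /(lt_le_trans g0).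
    by rewrite sub0r oppr_gt0 ltNge ler0n.
  have : x \in [seq x <- u | x \notin A] by rewrite E mem_head.
  rewrite mem_filter => /andP[xA xu].
  exists [:: (1, x)]; split; first by rewrite /subprob /mass big_seq1 /= ler01 lexx.
  move=> B g g0; rewrite /= has_filter E /= => /(lt_le_trans g0).
  rewrite subr_gt0; case: hasP => [_|h _]; first by rewrite ltxx.
  have xB : x \in B.
    apply: contraT => xB; case: h; exists x => //.
    by rewrite mem_cat (negPf xB) (negPf xA).
  by rewrite /mass big_mkcond big_seq1; case: ifP => // /negP[].
(* The [q] that is optimal for [A] stays admissible for [B ++ A], so the average for this [q] drops
   at least as much as the bound. *)
have [q hq e] := bound_ex (R := R) (m := m) l u A.
have [||D [sD hD]] := @guess_average l (m l) (take (m l) (level_phases R m l (remove q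
  u))) A IH.
- exact: m_gt0.
- by rewrite size_take; case: ltnP.
exists D; split=> // B g g0 hg; apply: hD => //; apply: le_trans hg _.
rewrite e lerB // avg_le_bound //; move: hq; rewrite !inE.
by case: q {e} => //= x; rewrite !(mem_map Some_inj) mem_cat => ->; rewrite orbT.
Qed.

(** Freeing a candidate lowers the average of the opening from at least [beta l] to below
    [beta l.+1], a gap of at least [beta l.+1], so each candidate is guessed with the corresponding
    chance. *)
Lemma few_candidates l (u s : seq T) : (m l <= size (level_phases R m l u))%N -> uniq s ->
  (forall x, x \in s -> level_average R m l u [:: x] < beta l.+1) ->
  (size s)%:R * chance l.+1 (beta l.+1) <= 1.
Proof.
move=> hm us hs.
have [||D [sD hD]] := @guess_average l (m l) (take (m l) (level_phases R m l u)) [::]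
  (guess l).
- exact: m_gt0.
- by rewrite size_take; case: ltnP.
apply: (count_mass sD us) => x /hs hx.
rewrite -(_ : mass D (mem [:: x]) = mass D (pred1 x)); last first.
  by apply: eq_bigl => d; exact: (mem_seq1 d.2 x).
apply: hD => /=; first exact: beta_gt0.
have := avg_ready (R := R) m_gt0 hm; rewrite beta_half; move: hx;
  rewrite /level_average; lra.
Qed.

(* The exponent of 1/2 in chance l (beta j). *)
Fixpoint rarity l j : nat := if l is l'.+1 then (j + 2 + 2 * rarity l' j.+1)%N else 0%N.

Lemma chance_beta l j : chance l (beta j) = beta (rarity l j).
Proof.
elim: l j => [|l IH] j //=.
rewrite (_ : beta j / 2 = beta j.+1); last by rewrite beta_half; field.
rewrite IH !betaE -exprM [(2 * _)%N]mulnC [RHS]exprD [in RHS]exprD.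
congr (_ * _ * _); by rewrite exprVn -natrX.
Qed.

Lemma rarity_le l j : (rarity l j <= 4 ^ l * (j + 2))%N.
Proof.
elim: l j => [//|l IH] j /=; have := IH j.+1.
rewrite expnS; have : (0 < 4 ^ l)%N by rewrite expn_gt0.
by nia.
Qed.

Lemma size_candidates l (u s : seq T) : (m l <= size (level_phases R m l u))%N -> uniq s
  ->
  (forall x, x \in s -> level_average R m l u [:: x] < beta l.+1) ->
  (size s <= 2 ^ rarity l.+1 l.+1)%N.
Proof.
move=> hm us hs; have := few_candidates hm us hs; rewrite chance_beta.
by rewrite betaE exprVn ler_pdivrMr ?exprn_gt0 // mul1r -natrX ler_nat.
Qed.

End Guess.

(** * The adversary *)

Section Move.
Variables (R : realFieldType) (T : eqType) (w : nat -> R).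
Hypothesis w_ge0 : forall i, 0 <= w i.

Definition move n (c c' : nat -> T) : R := \sum_(i < n) w i * (c i != c' i)%:R.

Lemma move_ge0 n c c' : 0 <= move n c c'.
Proof. by apply: sumr_ge0 => i _; rewrite mulr_ge0 ?ler0n. Qed.

Lemma move_refl n c : move n c c = 0.
Proof. by apply: big1 => i _; rewrite eqxx mulr0. Qed.

Lemma move_triangle n c c1 c2 : move n c c2 <= move n c c1 + move n c1 c2.
Proof.
rewrite -big_split; apply: ler_sum => i _ /=; rewrite -mulrDr ler_wpM2l //.
rewrite -natrD ler_nat; case: (eqVneq (c i) (c1 i)) => [->|_].
  by rewrite add0n.
by rewrite addSn; case: (_ != _).
Qed.

Lemma move_recr n c c' : move n.+1 c c' = move n c c' + w n * (c n != c' n)%:R.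
Proof. exact: big_ord_recr. Qed.

Lemma move_le_sum n c c' : move n c c' <= \sum_(i < n) w i.
Proof.
by apply: ler_sum => i _; case: (_ != _); rewrite ?mulr1 ?mulr0.
Qed.

End Move.

Section Schedule.
Variables (R : realFieldType) (T : eqType) (w : nat -> R).
Hypothesis w_ge0 : forall i, 0 <= w i.
Implicit Types (z : seq (T * (nat -> T))).

(* A schedule is a list of requests together with the configurations that serve
   them; only the moves of servers 0, ..., n-1 are paid for. *)
Fixpoint cost_from n c z : R :=
  if z is a :: z' then move w n c a.2 + cost_from n a.2 z' else 0.

Definition cost n z : R := if z is a :: z' then cost_from n a.2 z' else 0.

Lemma cost_from_ge0 n c z : 0 <= cost_from n c z.
Proof. by elim: z c => //= a z IH c; rewrite addr_ge0 ?move_ge0. Qed.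

Lemma cost_ge0 n z : 0 <= cost n z.
Proof. case: z => //= a z; exact: cost_from_ge0. Qed.

Lemma cost_le_from n c z : cost n z <= cost_from n c z.
Proof. by case: z => //= a z; rewrite lerDr move_ge0. Qed.

Lemma cost_from_triangle n c c' z :
  cost_from n c z <= move w n c c' + cost_from n c' z.
Proof.
case: z => [|a z] /=; first by rewrite addr0 move_ge0.
by rewrite addrA lerD2r move_triangle.
Qed.

(** Skipping a request merges two moves into one, by the triangle inequality. *)
Lemma cost_from_filter n c (P : pred (T * (nat -> T))) z :
  cost_from n c [seq b <- z | P b] <= cost_from n c z.
Proof.
elim: z c => //= a z IH c; case: (P a) => /=; first by rewrite lerD2l.
by apply: le_trans (cost_from_triangle n c a.2 _) _; rewrite lerD2l.
Qed.

Lemma cost_filter n (P : pred (T * (nat -> T))) z :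
  cost n [seq b <- z | P b] <= cost n z.
Proof.
case: z => //= a z; case: (P a); first exact: cost_from_filter.
exact: le_trans (cost_le_from _ a.2 _) (cost_from_filter _ _ _ _).
Qed.

Lemma cost_from_cat n c z z' :
  cost_from n c z + cost n z' <= cost_from n c (z ++ z').
Proof.
elim: z c => [|a z IH] c /=; first by rewrite add0r cost_le_from.
by rewrite -addrA lerD2l.
Qed.

Lemma cost_cat n z z' : cost n z + cost n z' <= cost n (z ++ z').
Proof. by case: z => [|a z] /=; rewrite ?add0r // cost_from_cat. Qed.

Lemma cost_from_widen n c z : cost_from n c z <= cost_from n.+1 c z.
Proof.
elim: z c => //= a z IH c; rewrite lerD // move_recr lerDl mulr_ge0 //.
Qed.

Lemma cost_from_fixed n c z :
  all (fun a => a.2 n == c n) z \/ w n <= cost_from n.+1 c z.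
Proof.
elim: z c => [|a z IH] c /=; first by left.
have [e|ne] := eqVneq (a.2 n) (c n); last first.
  right; rewrite move_recr eq_sym ne mulr1 addrAC lerDr.
  by rewrite addr_ge0 ?move_ge0 ?cost_from_ge0.
case: (IH a.2) => [h|h]; [left|right].
  by apply: sub_all h => b; rewrite e.
by apply: le_trans h _; rewrite lerDr move_ge0.
Qed.

Lemma cost_chunks n (P : pred (T * (nat -> T))) (S : seq (seq T)) rest z
    (F : seq T -> R) :
  map fst z = flatten S ++ rest -> all P z ->
  (forall v z', v \in S -> all P z' -> map fst z' = v -> F v <= cost n z') ->
  \sum_(v <- S) F v <= cost n z.
Proof.
elim: S z => [|v S IH] z hz Pz hF; first by rewrite big_nil cost_ge0.
rewrite big_cons -(cat_take_drop (size v) z).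
move: Pz; rewrite -{1}(cat_take_drop (size v) z) all_cat => /andP[P1 P2].
apply: le_trans (cost_cat _ _ _); apply: lerD.
  apply: hF => //; first exact: mem_head.
  by rewrite map_take hz /= -catA take_size_cat.
apply: IH => //; first by rewrite map_drop hz /= -catA drop_size_cat.
by move=> v' z' hv'; apply: hF; rewrite inE hv' orbT.
Qed.

Variable m : nat -> nat.
Hypothesis m_gt0 : forall l, (0 < m l)%N.
Hypothesis w_le_m : forall l, w l.+1 <= (m l)%:R * w l.
Local Notation bound := (@bound R T m).

Definition served n (A : seq T) (a : T * (nat -> T)) :=
  (a.1 \in A) || has (fun i => a.2 i == a.1) (iota 0 n).

(** Either server [l] moves and pays [w l], which suffices as [best] is at most 1, or it stays put
    and its position becomes a free point for the lighter servers. *)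
Lemma best_le_cost l z A :
  (forall z A, all (served l A) z -> w l * bound l (map fst z) A <= cost l z) ->
  all (served l.+1 A) z -> w l * best (bound l) (map fst z) A <= cost l.+1 z.
Proof.
move=> H; case: z => [|a z]; first by rewrite /best big_nil bound_nil mulr0.
move=> sz; case: (cost_from_fixed l a.2 z) => [fz|h]; last first.
  by apply: le_trans h; rewrite ler_piMr // best_le1.
apply: le_trans (cost_from_widen _ _ _).
apply: le_trans (H (a :: z) (a.2 l :: A) _).
  by rewrite ler_wpM2l // best_le_cons.
have {fz} : all (fun b => b.2 l == a.2 l) (a :: z) by rewrite /= eqxx.
elim: (a :: z) sz => //= b s IH /andP[sb ss] /andP[/eqP e es].
rewrite IH // andbT; move: sb; rewrite /served inE -addn1 iotaD has_cat /= orbF.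
by rewrite ?add0n e [b.1 == _]eq_sym; case: (_ == b.1); case: (b.1 \in A);
  rewrite ?orbT ?orbF.
Qed.

(** The schedule is restricted to the requests that survive [q] and cut along the phases;
    [w l.+1 <= m l * w l] absorbs the factor 1 / m l of the average. *)
Lemma bound_le_cost l z A : all (served l A) z ->
  w l * bound l (map fst z) A <= cost l z.
Proof.
elim: l z A => [|l IH] z A sz.
  rewrite (_ : bound 0 _ A = 0) ?mulr0 ?cost_ge0 //=.
  rewrite has_map (_ : has _ z = false) //; apply/negbTE; rewrite -all_predC.
  by apply: sub_all sz => a; rewrite /served /= orbF negbK.
have [q hq ->] := bound_ex (R := R) (m := m) l (map fst z) A.
pose P a := Some (a : T * (nat -> T)).1 != q.
apply: le_trans (cost_filter l.+1 P z).
have ez : map fst [seq b <- z | P b] = remove q (map fst z) by rewrite /remove filter_map.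
have {}sz : all (served l.+1 A) [seq b <- z | P b].
  by rewrite all_filter; apply: sub_all sz => a; rewrite /= => ->; rewrite implybT.
rewrite -ez; have [rest] := cat_phases (complete R m l) (map fst [seq b <- z | P b]).
rewrite -/(level_phases R m l _) /level_average; set S := level_phases R m l _.
rewrite -{1}(cat_take_drop (m l) S) flatten_cat -catA => eS.
apply: le_trans (cost_chunks (F := fun v => w l * best (bound l) v A) eS sz _).
  rewrite -mulr_sumr /average mulrA ler_wpM2r //.
    by apply: sumr_ge0 => v _; exact: best_ge0.
  by rewrite ler_pdivrMr ?ltr0n // mulrC.
by move=> v z' _ sz' <-; apply: best_le_cost => // ? ?; exact: IH.
Qed.

Lemma phases_le_cost l z : all (served l.+1 [::]) z ->
  w l * beta R l * (size (level_phases R m l (map fst z)))%:R <= cost l.+1 z.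
Proof.
move=> sz; have [rest e] := cat_phases (complete R m l) (map fst z).
apply: le_trans (cost_chunks (F := fun=> w l * beta R l) e sz _).
  by rewrite big_const_seq count_predT iter_addr addr0 mulr_natr.
move=> v z' hv sz' ev.
apply: le_trans (best_le_cost (@bound_le_cost l) sz'); rewrite ev ler_wpM2l //.
by have /allP := all_comp_phases (complete R m l) (map fst z); apply.
Qed.

End Schedule.

(** * Random orders *)

Section Harmonic.
Variable R : realFieldType.

Definition harmonic n : R := \sum_(i < n) i.+1%:R^-1.

Lemma harmonicS n : harmonic n.+1 = harmonic n + n.+1%:R^-1.
Proof. exact: big_ord_recr. Qed.

Lemma le_harmonic n p : (n <= p)%N -> harmonic n <= harmonic p.
Proof.
move=> /subnK <-; elim: (p - n)%N => [//|d IH].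
by rewrite addSn harmonicS; apply: le_trans IH _; rewrite lerDl invr_ge0.
Qed.

Lemma harmonic_double n : (0 < n)%N -> harmonic (n + n) <= harmonic n + 1.
Proof.
move=> n0; suff h d : harmonic (n + d) <= harmonic n + d%:R / n%:R.
  by apply: le_trans (h n) _; rewrite divff ?pnatr_eq0 -?lt0n.
elim: d => [|d IH]; first by rewrite addn0 mul0r addr0.
rewrite addnS harmonicS -[d.+1%:R]natr1 mulrDl mul1r addrA lerD //.
by rewrite lef_pV2 ?posrE ?ltr0n // ler_nat leqW // leq_addr.
Qed.

Lemma harmonic_exp2 e : harmonic (2 ^ e) <= e.+1%:R.
Proof.
elim: e => [|e IH]; first by rewrite /harmonic big_ord1 invr1.
rewrite expnS mul2n -addnn; apply: le_trans (harmonic_double _) _.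
  by rewrite expn_gt0.
by rewrite -natr1 lerD.
Qed.

(* Sorting by D, the summands become at most 1/n, 1/(n-1), ..., 1. *)
Lemma sum_rank_le_harmonic (T : eqType) (C : seq T) (D : T -> nat) :
  \sum_(x <- C) (count (fun y => D x <= D y)%N C)%:R^-1 <= harmonic (size C).
Proof.
pose leD x y := (D x <= D y)%N.
have leD_total : total leD by move=> x y; exact: leq_total.
have leD_trans : transitive leD by move=> x y z; exact: leq_trans.
have pC : perm_eq (sort leD C) C by rewrite perm_sort.
rewrite -(perm_size pC) -(perm_big _ pC) /=.
under eq_bigr do rewrite -(seq.permP pC).
have := sort_sorted leD_total C; elim: (sort leD C) => [|x s IH] /=.
  by rewrite big_nil /harmonic big_ord0.
move=> xs; have /allP xmin := order_path_min leD_trans xs.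
rewrite harmonicS big_cons addrC lerD //.
  apply: le_trans (IH (path_sorted xs)); rewrite big_seq [leRHS]big_seq.
  apply: ler_sum => y ys.
  have c0 : (0 < count (fun z => (D y <= D z)%N) s)%N.
    by rewrite -has_count; apply/hasP; exists y.
  by rewrite lef_pV2 ?posrE ?ltr0n ?ler_nat ?leq_addl // addn_gt0 c0 orbT.
rewrite leqnn (_ : count _ s = size s) //; apply/eqP; rewrite -all_count.
exact/allP.
Qed.

End Harmonic.

Section RandomMinimum.

(* By symmetry, each element of S is equally likely to be mapped to the minimum. *)
Lemma card_perm_min n (S : {set 'I_n}) i : i \in S ->
  (#|[set p : {perm 'I_n} | [forall j in S, p i <= p j]%N]| * #|S| <= n`!)%N.
Proof.
pose A i := [set p : {perm 'I_n} | [forall j in S, p i <= p j]%N].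
move=> iS; rewrite -/(A i).
have AE j : j \in S -> (#|A i| <= #|A j|)%N.
  (* Composing with the transposition of [i] and [j] sends [A i] injectively into [A j]. *)
  move=> jS; rewrite -(card_imset (mem (A i)) (@mulgI _ (tperm i j))).
  apply: subset_leq_card; apply/fintype.subsetP => _ /imsetP[p pA ->].
  rewrite inE in pA; rewrite inE; apply/forall_inP => k kS.
  rewrite !permM tpermR; apply: (forall_inP pA).
  by case: tpermP => // ->.
have -> : n`! = #|{: {perm 'I_n}}| by rewrite -card_Sn; apply: eq_card => p; rewrite inE.
apply: leq_trans (_ : (\sum_(j in S) #|A j| <= _)%N).
  by rewrite mulnC -sum_nat_const; apply: leq_sum => j /AE.
under eq_bigr do rewrite -sum1_card.
rewrite (exchange_big_dep predT) //= -sum1_card; apply: leq_sum => p _.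
rewrite sum1_card; apply/card_le1_eqP => j k.
move=> /andP[jS +] /andP[kS +]; rewrite !inE => /forall_inP hj /forall_inP hk.
by apply/(@perm_inj _ p)/val_inj/eqP; rewrite eqn_leq hj // hk.
Qed.

Variables (R : realFieldType) (T : eqType) (N : nat).

(* Meaningful only for x in C with size C <= N.+1, as inord has junk values. *)
Definition position (C : seq T) x : 'I_N.+1 := inord (index x C).

Lemma position_inj C : (size C <= N.+1)%N -> {in C &, injective (position C)}.
Proof.
move=> hC x y xC yC /(congr1 val); rewrite /= !inordK.
- by move=> e; rewrite -(nth_index x xC) e nth_index.
- by apply: leq_trans hC; rewrite index_mem.
- by apply: leq_trans hC; rewrite index_mem.
Qed.

Definition first_after (C : seq T) (D : T -> nat) (p : {perm 'I_N.+1}) x :=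
  all (fun y => (D x <= D y)%N ==> (p (position C x) <= p (position C y))%N) C.

(** An element comes first among those living at least as long with probability 1 over their number;
    these probabilities sum to at most a harmonic number. *)
Lemma sum_first_after C D : uniq C -> (size C <= N.+1)%N ->
  \sum_(x <- C) \sum_(p : {perm 'I_N.+1}) (first_after C D p x)%:R <=
  (N.+1`!)%:R * harmonic R (size C).
Proof.
move=> uC hC; apply: le_trans (ler_wpM2l _ (sum_rank_le_harmonic R C D)).
  rewrite mulr_sumr big_seq [leRHS]big_seq; apply: ler_sum => x xC.
  pose F := [seq y <- C | (D x <= D y)%N].
  pose S := [set i in map (position C) F].
  have FC : {subset F <= C} by move=> y; rewrite mem_filter => /andP[].
  have cS : #|S| = count (fun y => D x <= D y)%N C.
    rewrite cardsE (card_uniqP _) ?size_map ?size_filter // map_inj_in_uniq.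
      exact: filter_uniq.
    by move=> y z yF zF; apply: position_inj => //; exact: FC.
  have xS : position C x \in S by rewrite inE map_f // mem_filter leqnn.
  rewrite -cS ler_pdivlMr ?ltr0n; last by apply/card_gt0P; exists (position C x).
  rewrite -natr_sum -natrM ler_nat.
  apply: leq_trans (card_perm_min xS); rewrite leq_mul2r; apply/orP; right.
  rewrite -[leqRHS]sum1_card [leqRHS]big_mkcond; apply: leq_sum => p _; rewrite inE.
  case: ifPn => [_|/forall_inPn[j]]; first exact: leq_b1.
  rewrite inE => /mapP[y yF ->] hy; rewrite leqn0 eqb0; apply/allPn.
  exists y; first exact: FC.
  by move: yF; rewrite mem_filter => /andP[-> _].
by rewrite ler0n.
Qed.

End RandomMinimum.

(** * Prefixes and costs of runs *)

Section Prefixes.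
Variables (R : realFieldType) (T : eqType) (m : nat -> nat).

Lemma size_phs_cat l (s t : seq T) :
  (size (level_phases R m l s) <= size (level_phases R m l (s ++ t)))%N.
Proof.
elim/last_ind: t => [|t r IH]; first by rewrite cats0.
by rewrite -rcons_cat; have /andP[h _] := size_phases_rcons (complete R m l) (s ++ t) r;
  exact: leq_trans IH h.
Qed.

(** Once full, the opening is frozen for the rest of the phase, and with it the list of
    candidates. *)
Lemma take_phs_cat l (s t : seq T) : (m l <= size (level_phases R m l s))%N ->
  take (m l) (level_phases R m l (s ++ t)) = take (m l) (level_phases R m l s).
Proof.
move=> h; elim/last_ind: t => [|t r IH]; first by rewrite cats0.
by rewrite -rcons_cat /level_phases take_phases_rcons // (leq_trans h) // size_phs_cat.
Qed.

Lemma avg_cat l (s t A : seq T) : (m l <= size (level_phases R m l s))%N ->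
  level_average R m l (s ++ t) A = level_average R m l s A.
Proof. by move=> h; rewrite /level_average take_phs_cat. Qed.

Lemma bound_cat l (s t A : seq T) : bound R m l s A <= bound R m l (s ++ t) A.
Proof.
elim/last_ind: t => [|t r IH]; first by rewrite cats0.
by apply: le_trans IH _; rewrite -rcons_cat bound_rcons.
Qed.

End Prefixes.

Section Sums.
Variable R : realFieldType.

Lemma sum_drop_le1 (P : pred nat) n : (forall i, P i.+1 -> P i) ->
  \sum_(i < n) (P i && ~~ P i.+1)%:R <= 1 :> R.
Proof.
move=> hP; suff -> : \sum_(i < n) (P i && ~~ P i.+1)%:R = (P 0)%:R - (P n)%:R :> R.
  by case: (P 0); case: (P n) => /=; lra.
elim: n => [|n IH]; first by rewrite big_ord0 subrr.
rewrite big_ord_recr /= IH; have := hP n.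
by case: (P n); case: (P n.+1) => /= h; first [lra | have := h isT].
Qed.

(** [t] is the last index up to [n] at which [P] holds. A cost collected at selected times is thus
    bounded by the cost of a whole prefix. *)
Lemma sum_initial (P : pred nat) n : P 0 -> exists t, [/\ (t <= n)%N, P t &
  forall f : nat -> R, (forall i, 0 <= f i) ->
    \sum_(i < n) (P i.+1)%:R * f i <= \sum_(i < t) f i].
Proof.
move=> P0; elim: n => [|n [t [tn Pt IH]]].
  by exists 0; split => // f f0; rewrite !big_ord0.
case Pn : (P n.+1).
  exists n.+1; split => // f f0; apply: ler_sum => i _.
  by rewrite ler_piMl // lern1 leq_b1.
exists t; split => //; first exact: leqW.
by move=> f f0; rewrite big_ord_recr /= Pn mul0r addr0 IH.
Qed.

End Sums.

Lemma exists_min_seq (T : eqType) (f : T -> nat) (s : seq T) : s != [::] ->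
  exists2 x, x \in s & all (fun y => f x <= f y)%N s.
Proof.
case: s => // x s _; elim: s x => [|y s IH] x.
  by exists x; rewrite ?mem_head //= leqnn.
have [z zs zmin] := IH y; have [h|h] := leqP (f x) (f z).
  exists x; rewrite ?mem_head //; rewrite /= leqnn /=.
  by apply: sub_all zmin => a; apply: leq_trans.
exists z; first by rewrite inE zs orbT.
by rewrite /= (ltnW h).
Qed.

Section Run.
Variables (R : realFieldType) (T : eqType) (w : nat -> R).
Hypothesis w_ge0 : forall i, 0 <= w i.
Variable n : nat.

Definition run_cost (F : seq T -> nat -> T) s :=
  \sum_(i < size s) move w n (F (take i s)) (F (take i.+1 s)).

Lemma run_cost_ge0 F s : 0 <= run_cost F s.
Proof. by apply: sumr_ge0 => i _; exact: move_ge0. Qed.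

Lemma run_cost_rcons F s r :
  run_cost F (rcons s r) = run_cost F s + move w n (F s) (F (rcons s r)).
Proof.
rewrite /run_cost size_rcons big_ord_recr /=; congr (_ + move w n (F _) (F _)).
- by apply: eq_bigr => i _; rewrite -cats1 !takel_cat // ltnW.
- by rewrite -cats1 take_size_cat.
- by rewrite take_oversize ?size_rcons.
Qed.

(** A request to the removed point leaves the filtered string, hence the configuration,
    unchanged. *)
Lemma run_cost_remove F q s t : (t <= size s)%N ->
  \sum_(i < t) move w n (F (remove q (take i s))) (F (remove q (take i.+1 s))) =
  run_cost F (remove q (take t s)).
Proof.
elim: t => [|t IH] ts; first by rewrite take0 big_ord0 /run_cost big_ord0.
have [x0 _] : exists x : T, x \in s by case: (s) ts => // x ? _; exists x;
  rewrite mem_head.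
rewrite big_ord_recr /= IH ?(ltnW ts) // (take_nth x0) // remove_rcons.
by case: ifP => _; rewrite ?run_cost_rcons // move_refl addr0.
Qed.

(** The constant [W] pays for the jump of the servers when a phase starts. *)
Lemma run_cost_phases (comp : pred (seq T)) F W s :
  ~~ comp [::] -> (forall c c' : nat -> T, move w n c c' <= W) ->
  run_cost (fun s => F (current comp s)) s <=
  \sum_(v <- phases comp s) (W + run_cost F v) +
  (if comp (current comp s) then 0 else W + run_cost F (current comp s)).
Proof.
move=> nc hW; have W0 : 0 <= W := le_trans (move_ge0 w_ge0 n (F [::]) (F [::])) (hW _ _).
elim/last_ind: s => [|s r IH].
  rewrite -[current comp [::]]/[::] -[phases comp [::]]/[::] (negPf nc).
  by rewrite /run_cost /= !big_ord0 big_nil add0r addr0.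
rewrite run_cost_rcons phases_rcons.
have -> : forall X Y (b : bool), \sum_(v <- if b then rcons X Y else X) (W + run_cost F
  v) +
    (if b then 0 else W + run_cost F Y) = \sum_(v <- X) (W + run_cost F v) + (W +
      run_cost F Y).
  by move=> X Y [] //; rewrite big_rcons addr0.
rewrite !current_rcons; move: IH; case: ifP => _ IH.
  apply: lerD; first by rewrite addr0 in IH.
  by apply: le_trans (hW _ _) _; rewrite lerDl run_cost_ge0.
by rewrite run_cost_rcons !addrA lerD2r -addrA.
Qed.

End Run.

(** * The algorithm *)

Definition slots l := (2 ^ rarity l.+1 l.+1)%N.

(* One random order per level suffices: it is reused in all phases of this level,
   since expectations are additive whatever the dependence between phases. *)
Fixpoint seeds (l : nat) : finType :=
  if l is l'.+1 then (seeds l' * {perm 'I_(slots l').+1})%type else unit.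

Section Algorithm.
Variables (R : realFieldType) (T : eqType) (m : nat -> nat) (x0 : T).
Hypothesis m_gt0 : forall l, (0 < m l)%N.
Local Notation bound := (@bound R T m).
Local Notation level_phases := (@level_phases R T m).
Local Notation complete := (@complete R T m).
Local Notation level_average := (@level_average R T m).
Local Notation beta := (@beta R).

Definition candidates l u :=
  [seq x <- undup (flatten (take (m l) (level_phases l u))) | level_average l u [:: x] <
    beta l.+1].

(** By [bound_rcons] the bound grows with the phase, so a dead candidate never revives. *)
Definition alive l u := [seq x <- candidates l u | bound l.+1 u [:: x] < beta l.+1].

Definition rank l (p : {perm 'I_(slots l).+1}) u x : nat :=
  p (position (slots l) (candidates l u) x).

Definition target l (p : {perm 'I_(slots l).+1}) u : option T :=
  if (size (level_phases l u) < m l)%N then None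
  else ohead [seq x <- alive l u | all (fun y => rank p u x <= rank p u y)%N (alive l u)].

(* The position of server i is conf om s i; it is irrelevant for i > l.  While
   there is no target, server l+1 is parked at x0 and the level-l algorithm
   serves all requests. *)
Fixpoint conf l : seeds l -> seq T -> nat -> T :=
  if l is l'.+1 then fun om s i =>
    let u := current (complete l'.+1) s in let h := target om.2 u in
    if i == l'.+1 then odflt x0 h else conf om.1 (remove h u) i
  else fun _ s _ => last x0 s.

(** When the target changes, the lighter servers jump to where the lower algorithm would be, had it
    served the whole phase so far without the requests to the new target. *)
Definition phase_conf l : seeds l -> seq T -> nat -> T :=
  if l is l'.+1 then fun om u i =>
    if i == l'.+1 then odflt x0 (target om.2 u) else conf om.1 (remove (target om.2 u)
      u) i
  else fun _ u _ => last x0 u.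

Lemma conf_phase l (om : seeds l) s : conf om s = phase_conf om (current (complete l) s).
Proof. by case: l om => [|l] om //=; rewrite last_current. Qed.

Lemma candidates_uniq l u : uniq (candidates l u).
Proof. by rewrite filter_uniq // undup_uniq. Qed.

Lemma candidates_cat l u v : (m l <= size (level_phases l u))%N ->
  candidates l (u ++ v) = candidates l u.
Proof.
move=> h; rewrite /candidates take_phs_cat //; apply: eq_filter => x.
by rewrite avg_cat.
Qed.

Lemma size_candidates_le l u : (m l <= size (level_phases l u))%N ->
  (size (candidates l u) <= slots l)%N.
Proof.
move=> h; apply: (@size_candidates R T m m_gt0 l u) => //; first exact: candidates_uniq.
by move=> x; rewrite mem_filter => /andP[].
Qed.

(** A point outside the opening occurs in none of its phases, so freeing it leaves the average at
    least [beta l]. *)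
Lemma bound_candidate l u x : (m l <= size (level_phases l u))%N ->
  bound l.+1 u [:: x] < beta l.+1 -> x \in candidates l u.
Proof.
move=> h bx; have ax := le_lt_trans (avg0_le_bound l u [:: x]) bx.
rewrite mem_filter ax mem_undup; apply: contraLR ax => /negP hx.
rewrite -leNgt; apply: le_trans (ltW (betaS_lt l)) _.
apply: le_trans (avg_ready m_gt0 h) _; rewrite le_eqVlt; apply/orP; left.
apply/eqP; congr (_ * _); apply: eq_big_seq => v hv.
rewrite best_bound_notin //; apply/negP => xv; apply: hx.
by apply/flattenP; exists v.
Qed.

Lemma mem_alive l u x : (m l <= size (level_phases l u))%N ->
  (x \in alive l u) = (bound l.+1 u [:: x] < beta l.+1).
Proof.
move=> h; rewrite mem_filter; have := @bound_candidate l u x h.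
by case: (_ < _) => // ->.
Qed.

Lemma target_some l p u x : @target l p u = Some x ->
  [/\ (m l <= size (level_phases l u))%N, x \in alive l u &
      forall y, y \in alive l u -> (rank p u x <= rank p u y)%N].
Proof.
rewrite /target; case: ltnP => // h.
set s := [seq _ <- _ | _]; case E : s => [//|z r] [<-].
have : z \in s by rewrite E mem_head.
by rewrite mem_filter => /andP[/allP zmin za]; split.
Qed.

(** In an incomplete phase [best] is small. If the opening is full, this minimum is not the default
    value, which is at least [beta l]; so it is reached at a living candidate, and a target
    exists. *)
Lemma target_none l p u : @target l p u = None -> ~~ complete l.+1 u ->
  (size (level_phases l u) < m l)%N.
Proof.
rewrite /target; case: ltnP => // h; set s := [seq _ <- _ | _] => sN nc.
have s0 : s = [::] by case: s sN.
suff [x xa] : exists x, x \in alive l u.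
  have aN : alive l u != [::] by apply/eqP => e; rewrite e in xa.
  have [z za zmin] := exists_min_seq (rank p u) aN.
  have : z \in s by rewrite mem_filter zmin za.
  by rewrite s0.
rewrite incompleteE in nc; case: (best_ex (bound l.+1) u [::]) => [e|[x _ e]].
  have := lt_le_trans nc (ltW (betaS_lt l)); rewrite e ltNge.
  by rewrite (le_trans (avg_ready m_gt0 h)) // avg0_le_bound.
by exists x; rewrite mem_alive // -e.
Qed.

Lemma target_eq l p u x : (m l <= size (level_phases l u))%N -> x \in alive l u ->
  (forall y, y \in alive l u -> (rank p u x <= rank p u y)%N) -> @target l p u = Some x.
Proof.
move=> h xa xmin; case E : (target p u) => [z|].
  have [_ za zmin] := target_some E; congr Some.
  have sub y : y \in alive l u -> y \in candidates l u by rewrite mem_filter => /andP[].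
  apply: (position_inj (leqW (size_candidates_le h))); rewrite ?sub //.
  by apply/(@perm_inj _ p)/val_inj/eqP; rewrite eqn_leq; apply/andP; split;
    [exact: zmin|exact: xmin].
move: E; rewrite /target ltnNge h /=; set s := [seq _ <- _ | _] => sN.
have : x \in s by rewrite mem_filter xa andbT; apply/allP.
by case: s sN.
Qed.

(** A request to the position of the heaviest server is served there; any other one survives
    [remove] and is served by a lower level. *)
Lemma conf_serves l (om : seeds l) s r :
  has (fun i => conf om (rcons s r) i == r) (iota 0 l.+1).
Proof.
elim: l om s => [|l IH] om s; first by rewrite /= last_rcons eqxx.
rewrite conf_phase; have [u ->] : exists u, current (complete l.+1) (rcons s r) = rcons
  u r.
  by rewrite current_rcons; case: ifP => _; [exists [::]|eexists].
have -> : iota 0 l.+2 = iota 0 l.+1 ++ [:: l.+1] by rewrite -[l.+2]addn1 iotaD.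
rewrite has_cat [X in _ || X]/= eqxx orbF.
have [_|ne] := eqVneq (odflt x0 _) r; first by rewrite orbT.
rewrite orbF; have := IH om.1 (remove (target om.2 (rcons u r)) u).
set h := target _ _ in ne *.
have -> : rcons (remove h u) r = remove h (rcons u r).
  by rewrite remove_rcons; case: eqP => // e; rewrite -e eqxx in ne.
move=> /hasP[i]; rewrite mem_iota => /andP[_ il] ei; apply/hasP; exists i.
  by rewrite mem_iota.
by rewrite /= ltn_eqF.
Qed.

End Algorithm.

(** * Expected cost of the algorithm *)

Section PhaseCost.
Variables (R : realFieldType) (T : eqType) (m : nat -> nat) (x0 : T) (w : nat -> R).
Hypothesis m_gt0 : forall l, (0 < m l)%N.
Hypothesis w_ge0 : forall i, 0 <= w i.
Hypothesis w_mono : forall i, w i <= w i.+1.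
Local Notation bound := (@bound R T m).
Local Notation level_phases := (@level_phases R T m).
Local Notation complete := (@complete R T m).
Local Notation beta := (@beta R).
Local Notation conf := (@conf R T m x0 _).
Local Notation phase_conf := (@phase_conf R T m x0 _).
Local Notation target := (@target R T m _).
Local Notation candidates := (@candidates R T m).

Definition diameter l : R := l.+1%:R * w l.

Lemma le_weight i j : (i <= j)%N -> w i <= w j.
Proof.
move=> /subnK <-; elim: (j - i)%N => [//|d IH].
by rewrite addSn; apply: le_trans IH (w_mono _).
Qed.

Lemma move_le_diameter l (c c' : nat -> T) : move w l.+1 c c' <= diameter l.
Proof.
apply: le_trans (move_le_sum w_ge0 _ _ _) _.
apply: le_trans (ler_sum _ (_ : forall i : 'I_l.+1, true -> _ <= w l)) _.
  by move=> i _; apply: le_weight; rewrite -ltnS.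
by rewrite sumr_const card_ord -mulr_natl.
Qed.

Lemma diameter_ge0 l : 0 <= diameter l.
Proof. by rewrite mulr_ge0. Qed.

Lemma phase_step_cost l (om : seeds l.+1) u u' :
  move w l.+2 (phase_conf om u) (phase_conf om u') <=
  (target om.2 u == target om.2 u')%:R *
     move w l.+1 (conf om.1 (remove (target om.2 u) u))
                 (conf om.1 (remove (target om.2 u) u')) +
  (target om.2 u != target om.2 u')%:R * diameter l.+1.
Proof.
case: eqP => [e|_]; last by rewrite mul0r add0r mul1r move_le_diameter.
rewrite mul1r mul0r addr0 move_recr.
have -> : phase_conf om u' l.+1 = phase_conf om u l.+1 by rewrite /= eqxx e.
rewrite eqxx mulr0 addr0.
rewrite le_eqVlt; apply/orP; left; apply/eqP; apply: eq_bigr => i _.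
by rewrite /= !(ltn_eqF (ltn_ord i)) e.
Qed.

(* u0 is what the level-l algorithm serves during the opening, uf x what it can
   serve with server l+1 at x, and D x the time of death of x.  None of them
   depends on the seed, and only the candidates that come first among those
   living at least as long are ever visited. *)
Lemma phase_cost l tau : fresh (complete l.+1) tau ->
  exists u0 (uf : T -> seq T) C (D : T -> nat),
  [/\ (size (level_phases l u0) <= m l)%N, (forall x, size (level_phases l (uf x)) < m
    l)%N,
      uniq C, (size C <= slots l)%N &
   forall om : seeds l.+1, run_cost w l.+2 (phase_conf om) tau <=
     diameter l.+1 + run_cost w l.+1 (conf om.1) u0 +
     \sum_(x <- C) (first_after C D om.2 x)%:R *
        (diameter l.+1 + run_cost w l.+1 (conf om.1) (uf x))].
Proof.
move=> ftau; set n := size tau; pose pre i := take i tau.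
have preS i j : (i <= j)%N -> exists t, pre j = pre i ++ t.
  by move=> ij; exists (drop i (pre j));
    rewrite -{1}(cat_take_drop i (pre j)) /pre take_takel.
have phs_mono i j : (i <= j)%N -> (size (level_phases l (pre i)) <= size (level_phases l
  (pre j)))%N.
  by move=> /preS[t ->]; exact: size_phs_cat.
have bound_mono i j x : (i <= j)%N -> bound l.+1 (pre i) [:: x] <= bound l.+1 (pre j)
  [:: x].
  by move=> /preS[t ->]; exact: bound_cat.
pose live x i := bound l.+1 (pre i) [:: x] < beta l.+1.
have live_anti x i j : (i <= j)%N -> live x j -> live x i.
  by move=> ij; apply: le_lt_trans; exact: bound_mono.
pose C := if (m l <= size (level_phases l tau))%N then candidates l tau else [::].
have candE i : (i <= n)%N -> (m l <= size (level_phases l (pre i)))%N -> candidates l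
  (pre i) = C.
  move=> iN hi; have [t et] := preS _ _ iN; rewrite /pre take_size -/(pre i) in et.
  have hn : (m l <= size (level_phases l tau))%N by rewrite et;
    exact: leq_trans hi (size_phs_cat _ _ _ _ _).
  by rewrite /C hn et candidates_cat.
(* A candidate that survives the phase gets [D x = n.+1], the default of [find]. *)
pose D x := find (fun i => ~~ live x i) (iota 0 n.+1).
have DP x i : (i <= n)%N -> (i < D x)%N = live x i.
  move=> iN; apply/idP/idP => [h|lxi].
    by have /negbFE := before_find 0%N h; rewrite nth_iota ?add0n // ltnS.
  rewrite ltnNge; apply/negP => h.
  have hs : has (fun i => ~~ live x i) (iota 0 n.+1).
    by rewrite has_find size_iota; apply: leq_ltn_trans h _; rewrite ltnS.
  have := nth_find 0%N hs; rewrite -/(D x) nth_iota ?add0n; last first.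
    by apply: leq_ltn_trans h _; rewrite ltnS.
  by rewrite (live_anti _ _ _ h lxi).
have phs_pre0 q : level_phases l (remove q (pre 0%N)) = [::] by rewrite /pre take0.
(* Equality with [m l] is allowed here, since the last request may finish the opening and the phase
   at once, leaving no target. *)
have [|t0 [t0n Pt0 sum0]] :=
  @sum_initial R (fun i => size (level_phases l (remove None (pre i))) <= m l)%N n.
  by rewrite phs_pre0.
have /choice[tf htf] : forall x, exists t, [/\ (t <= n)%N,
    (size (level_phases l (remove (Some x) (pre t))) < m l)%N &
    forall f : nat -> R, (forall i, 0 <= f i) ->
    \sum_(i < n) (size (level_phases l (remove (Some x) (pre i.+1))) < m l)%N%:R * f i <=
      \sum_(i < t) f i].
  by move=> x; apply: (@sum_initial R (fun i => _ < _)%N); rewrite phs_pre0.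
exists (remove None (pre t0)), (fun x => remove (Some x) (pre (tf x))), C, D; split => //.
- by move=> x; have [] := htf x.
- by rewrite /C; case: ifP => // _; exact: candidates_uniq.
- by rewrite /C; case: ifP => // h; exact: size_candidates_le.
move=> om; pose h i := target om.2 (pre i).
have h_some i x : (i <= n)%N -> h i = Some x ->
    [/\ (m l <= size (level_phases l (pre i)))%N, x \in C, live x i &
     forall y, y \in C -> live y i ->
       (om.2 (position (slots l) C x) <= om.2 (position (slots l) C y))%N].
  move=> iN /target_some[hm xa xmin].
  have := xa; rewrite mem_alive // => xl; split => //.
    by rewrite -(candE i) //; exact: bound_candidate.
  move=> y yC yl; have := xmin y; rewrite mem_alive // /rank candE //.
  exact.
pose mv q i := move w l.+1 (conf om.1 (remove q (pre i))) (conf om.1 (remove q (pre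
  i.+1))).
pose t q i := (h i == q)%:R *
  ((q == h i.+1)%:R * mv q i + (q != h i.+1)%:R * diameter l.+1).
have mv_ge0 q i : 0 <= mv q i by exact: move_ge0.
have t_ge0 q i : 0 <= t q i.
  by rewrite mulr_ge0 // addr_ge0 // mulr_ge0 // diameter_ge0.
have step i : (i < n)%N -> move w l.+2 (phase_conf om (pre i)) (phase_conf om (pre
  i.+1)) <=
    \sum_(q <- None :: map Some C) t q i.
  move=> iN; have hq : h i \in None :: map Some C.
    case E : (h i) => [x|] //; have [_ xC _ _] := h_some _ _ (ltnW iN) E.
    by rewrite inE /= (mem_map Some_inj).
  apply: le_trans (phase_step_cost om (pre i) (pre i.+1)) _.
  by rewrite (big_rem _ hq) /= {1}/t eqxx mul1r lerDl sumr_ge0.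
have pre_rcons i : (i < n)%N -> exists r, pre i.+1 = rcons (pre i) r.
  move=> iN; have /hasP[a _ _] : has predT tau.
    by rewrite has_predT (leq_ltn_trans _ iN).
  by exists (nth a tau i); rewrite /pre -take_nth.
rewrite {1}/run_cost -/n.
apply: le_trans (_ : \sum_(i < n) \sum_(q <- None :: map Some C) t q i <= _).
  by apply: ler_sum => i _; apply: step.
rewrite exchange_big /= big_cons big_map lerD //.
  apply: le_trans (_ : \sum_(i < n)
    (((size (level_phases l (pre i)) < m l)%N && ~~ (size (level_phases l (pre i.+1)) <
      m l)%N)%:R * diameter l.+1
     + (size (level_phases l (remove None (pre i.+1))) <= m l)%N%:R * mv None i) <= _).
    apply: ler_sum => i _; rewrite /t; case: eqP => [hi|_]; last first.
      by rewrite mul0r addr_ge0 // mulr_ge0 // diameter_ge0.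
    have hm := target_none m_gt0 hi (ftau i (ltn_ord i)).
    rewrite mul1r addrC hm /=; apply: lerD.
      rewrite ler_wpM2r ?diameter_ge0 // ler_nat.
      case E : (h i.+1) => [x|] //.
      by have [hm' _ _ _] := h_some i.+1 x (ltn_ord i) E; rewrite -leqNgt hm'.
    rewrite ler_wpM2r // ler_nat remove_none.
    have [r ->] := pre_rcons i (ltn_ord i).
    have /andP[_ hs] := size_phases_rcons (complete l) (pre i) r.
    by rewrite (leq_trans hs hm) leq_b1.
  rewrite big_split /= -mulr_suml lerD //.
    rewrite ler_piMl ?diameter_ge0 //.
    apply: (@sum_drop_le1 R (fun i => size (level_phases l (pre i)) < m l)%N) => i.
    exact: leq_ltn_trans (phs_mono _ _ (leqnSn i)).
  apply: le_trans (sum0 _ (mv_ge0 None)) _.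
  by rewrite /pre -run_cost_remove.
rewrite big_seq [leRHS]big_seq; apply: ler_sum => x xC.
(* If [x] is not first, a candidate living at least as long precedes it in the order, so [x] is
   never the target. *)
case: (boolP (first_after _ _ _ _)) => [_|/allPn[y yC]]; last first.
  rewrite negb_imply => /andP[Dxy /negP yx]; rewrite mul0r big1 // => i _.
  rewrite /t; case: eqP => [hi|]; last by rewrite mul0r.
  have [_ _ xl xmin] := h_some _ _ (ltnW (ltn_ord i)) hi.
  case: yx; apply: xmin => //; rewrite -DP ?(ltnW (ltn_ord i)) //.
  by apply: leq_trans Dxy; rewrite DP // ltnW.
rewrite mul1r; have [tn _ sumx] := htf x.
apply: le_trans (_ : \sum_(i < n) ((live x i && ~~ live x i.+1)%:R * diameter l.+1
     + (size (level_phases l (remove (Some x) (pre i.+1))) < m l)%N%:R * mv (Some x) i)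
       <= _).
  apply: ler_sum => i _; rewrite /t; case: eqP => [hi|_]; last first.
    by rewrite mul0r addr_ge0 // mulr_ge0 // diameter_ge0.
  have [hm _ xl xmin] := h_some _ _ (ltnW (ltn_ord i)) hi.
  rewrite mul1r addrC xl /=; apply: lerD.
    rewrite ler_wpM2r ?diameter_ge0 // ler_nat; case: eqP => //= ne.
    (* A living target is kept: the candidates alive after the step were alive before it, when [x]
       was first among them. *)
    case xl' : (live x i.+1) => //; case: ne; apply/esym.
    have hm' := leq_trans hm (phs_mono _ _ (leqnSn i)).
    apply: target_eq => //; first by rewrite mem_alive.
    move=> y; rewrite mem_alive // => yl; rewrite /rank candE //.
    apply: xmin; last exact: live_anti yl.
    by rewrite -(candE i.+1) //; exact: bound_candidate.
  rewrite ler_wpM2r // ler_nat; case: eqP => // /esym hi'.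
  have [_ _ xl' _] := h_some i.+1 x (ltn_ord i) hi'.
  by rewrite (ready_remove m_gt0 xl').
rewrite big_split /= -mulr_suml lerD //.
  rewrite ler_piMl ?diameter_ge0 //; apply: (@sum_drop_le1 R (live x)) => i.
  exact: live_anti.
apply: le_trans (sumx _ (mv_ge0 (Some x))) _.
by rewrite /pre -run_cost_remove.
Qed.

End PhaseCost.

(** Expected cost of a phase in units of [w l], its initial jump included. At most [rarity + 1]
    targets are expected; each costs a diameter and at most [m l] phases of the level below. The
    other 2 covers the initial jump and the opening, which is charged [m l + 1] phases; the 3 comes
    from [m l * w l <= 2 * w l.+1]. *)
Fixpoint ratio l : nat :=
  if l is l'.+1 then (rarity l'.+1 l'.+1 + 3) * (l'.+2 + 3 * ratio l') else 3.

Section ExpectedCost.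
Variables (R : realFieldType) (T : eqType) (m : nat -> nat) (x0 : T) (w : nat -> R).
Hypothesis m_gt0 : forall l, (0 < m l)%N.
Hypothesis w_ge0 : forall i, 0 <= w i.
Hypothesis w_mono : forall i, w i <= w i.+1.
Hypothesis m_le_w : forall l, (m l)%:R * w l <= 2 * w l.+1.
Local Notation level_phases := (@level_phases R T m).
Local Notation complete := (@complete R T m).
Local Notation conf := (@conf R T m x0 _).
Local Notation phase_conf := (@phase_conf R T m x0 _).

Lemma expected_cost_of_phase l :
  (forall tau, fresh (complete l) tau ->
    \sum_(om : seeds l) (diameter w l + run_cost w l.+1 (phase_conf om) tau) <=
      #|seeds l|%:R * ((ratio l)%:R * w l)) ->
  forall s, \sum_(om : seeds l) run_cost w l.+1 (conf om) s <=
    #|seeds l|%:R * ((ratio l)%:R * w l) * (size (level_phases l s)).+1%:R.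
Proof.
move=> H s; set K := _ * (_ * _).
have K0 : 0 <= K by rewrite !mulr_ge0.
have [fp fc] := fresh_phases (complete_nil R T m l) s.
apply: le_trans (_ : \sum_(om : seeds l)
  (\sum_(v <- level_phases l s) (diameter w l + run_cost w l.+1 (phase_conf om) v) +
  (if complete l (current (complete l) s) then 0
   else diameter w l + run_cost w l.+1 (phase_conf om) (current (complete l) s))) <= _).
  apply: ler_sum => om _.
  rewrite (_ : run_cost w l.+1 (conf om) s =
    run_cost w l.+1 (fun s => phase_conf om (current (complete l) s)) s).
    apply: (run_cost_phases w_ge0 _ _ (complete_nil R T m l)) => c c'.
    exact: move_le_diameter.
  by apply: eq_bigr => i _; rewrite !conf_phase.
rewrite big_split /= exchange_big /= -natr1 mulrDr mulr1 lerD //.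
  apply: le_trans (_ : \sum_(v <- level_phases l s) K <= _).
    by rewrite big_seq [leRHS]big_seq; apply: ler_sum => v /fp; exact: H.
  by rewrite big_const_seq count_predT iter_addr addr0 mulr_natr.
by case: (complete l (current (complete l) s)); [rewrite big1|exact: H].
Qed.

(** As [beta 0] is 1, an incomplete string requests at most one point. So server 0 moves only at the
    first and last requests of a phase; the third [w 0] is the initial jump. *)
Lemma expected_phase0 tau : fresh (complete 0) tau ->
  \sum_(om : seeds 0) (diameter w 0 + run_cost w 1 (phase_conf om) tau) <=
    #|seeds 0|%:R * ((ratio 0)%:R * w 0%N).
Proof.
have same u x y : ~~ complete 0 u -> x \in u -> y \in u -> x = y.
  rewrite incompleteE betaE expr0 => h xu yu.
  case: (best_ex (bound R m 0) u [::]) => [e|[z _ e]].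
    move: h; rewrite e /= (_ : has _ u = true) ?ltxx //.
    by apply/hasP; exists x.
  have allz : {in u, forall a, a = z}.
    move=> a au; apply/eqP; apply: contraTT h => az; rewrite e -leNgt /=.
    by case: hasP => // -[]; exists a => //; rewrite inE.
  by rewrite (allz x xu) (allz y yu).
have move1 F (c c' : seq T) : move w 1 (F c) (F c') <= w 0%N.
  by apply: le_trans (move_le_sum w_ge0 _ _ _) _; rewrite big_ord1.
have c1 (om : seeds 0) u : fresh (complete 0) u -> ~~ complete 0 u ->
    run_cost w 1 (phase_conf om) u <= w 0%N.
  elim/last_ind: u => [|u r IH] fu cu; first by rewrite /run_cost big_ord0.
  have cu' : ~~ complete 0 u.
    by have := fu (size u); rewrite size_rcons -cats1 take_size_cat // => ->.
  have fu' : fresh (complete 0) u.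
    by move=> i iu; have := fu i; rewrite size_rcons -cats1 takel_cat 1?ltnW // => ->.
  rewrite run_cost_rcons; case: (lastP u) cu IH fu' cu' => [|u' r'] cu IH fu' cu'.
    by rewrite {1}/run_cost big_ord0 add0r move1.
  have -> : r = r'.
    apply: (same (rcons (rcons u' r') r)) => //; first by rewrite mem_rcons mem_head.
    by rewrite mem_rcons inE mem_rcons mem_head orbT.
  by rewrite /= !last_rcons move_refl addr0; exact: IH.
move=> ft; have ht (om : seeds 0) : run_cost w 1 (phase_conf om) tau <= 2 * w 0%N.
  case/lastP: tau ft => [|u r] ft; first by rewrite /run_cost big_ord0 mulr_ge0.
  rewrite run_cost_rcons mulr2n mulrDl mul1r lerD //; apply: c1.
    by move=> i iu; have := ft i; rewrite size_rcons -cats1 takel_cat 1?ltnW // => ->.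
  by have := ft (size u); rewrite size_rcons -cats1 take_size_cat // => ->.
apply: le_trans (ler_sum _ (_ : forall om : seeds 0, true -> _ <= 3 * w 0%N)) _.
  by move=> om _; have := ht om; rewrite /diameter; lra.
by rewrite sumr_const -[leLHS]mulr_natl.
Qed.

Lemma expected_phaseS l :
  (forall s, \sum_(om : seeds l) run_cost w l.+1 (conf om) s <=
    #|seeds l|%:R * ((ratio l)%:R * w l) * (size (level_phases l s)).+1%:R) ->
  forall tau, fresh (complete l.+1) tau ->
    \sum_(om : seeds l.+1) (diameter w l.+1 + run_cost w l.+2 (phase_conf om) tau) <=
      #|seeds l.+1|%:R * ((ratio l.+1)%:R * w l.+1).
Proof.
move=> H tau ftau.
have [u0 [uf [C [D [hu0 huf uC sC hcost]]]]] := phase_cost x0 m_gt0 w_ge0 w_mono ftau.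
set W := diameter w l.+1; have W0 : 0 <= W by exact: diameter_ge0.
set E := (ratio l)%:R * w l in H; set W' := w l.+1.
have E0 : 0 <= E by rewrite mulr_ge0.
pose A u (om : seeds l) := run_cost w l.+1 (conf om) u.
have HA u k : (size (level_phases l u) < k)%N ->
    \sum_(om : seeds l) A u om <= #|seeds l|%:R * (E * k%:R).
  move=> hk; apply: le_trans (H u) _; rewrite -mulrA !ler_wpM2l ?mulr_ge0 //.
  by rewrite ler_nat.
pose B x om := W + A (uf x) om.
have HB x : \sum_(om : seeds l) B x om <= #|seeds l|%:R * (W + E * (m l)%:R).
  rewrite big_split /= sumr_const -[W *+ _]mulr_natl mulrDr lerD2l.
  exact: HA.
apply: le_trans (_ : \sum_(om : seeds l) \sum_(p : {perm 'I_(slots l).+1})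
   (2 * W + A u0 om + \sum_(x <- C) (first_after C D p x)%:R * B x om) <= _).
  rewrite pair_bigA /=; apply: ler_sum => om _.
  by have := hcost om; rewrite /B /A -/W; lra.
under eq_bigr => om _ do
  rewrite big_split /= sumr_const -[_ *+ _]mulr_natl exchange_big /=.
rewrite big_split /= -mulr_sumr big_split /= sumr_const -[_ *+ #|seeds l|]mulr_natl.
(* The order [p] is independent of the seeds of the lower levels, so the expectation of the product
   factors. *)
have e x : \sum_om \sum_(p : {perm 'I_(slots l).+1}) (first_after C D p x)%:R * B x om =
    (\sum_(p : {perm 'I_(slots l).+1}) (first_after C D p x)%:R) * \sum_om B x om.
  by rewrite mulr_suml exchange_big; apply: eq_bigr => p _; rewrite mulr_sumr.
rewrite [X in _ + X <= _]exchange_big /= [X in _ + X <= _](eq_bigr _ (fun x _ => e x)).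
set P : R := #|{: {perm 'I_(slots l).+1}}|%:R; set S : R := #|seeds l|%:R.
have PS : #|seeds l.+1|%:R = P * S by rewrite card_prod natrM mulrC.
have hP : P = ((slots l).+1)`!%:R.
  by rewrite /P -card_Sn; congr _%:R; apply: eq_card => p; rewrite inE.
have hsum : \sum_(x <- C) (\sum_(p : {perm 'I_(slots l).+1}) (first_after C D p x)%:R) *
   (\sum_(om : seeds l) B x om) <= P * (rarity l.+1 l.+1).+1%:R * (S * (W + E * (m
     l)%:R)).
  apply: le_trans (_ : \sum_(x <- C)
    (\sum_(p : {perm 'I_(slots l).+1}) (first_after C D p x)%:R) * (S * (W + E * (m
      l)%:R)) <= _).
    by apply: ler_sum => x _; rewrite ler_wpM2l ?sumr_ge0.
  rewrite -mulr_suml ler_wpM2r ?mulr_ge0 ?addr_ge0 ?mulr_ge0 //.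
  apply: le_trans (sum_first_after R D uC (leqW sC)) _.
  rewrite -hP ler_wpM2l // (le_trans _ (harmonic_exp2 _ _)) //.
  exact: le_harmonic.
have := HA u0 (m l).+1 hu0; rewrite -/S => hA.
apply: le_trans (lerD (ler_wpM2l (ler0n _ _) (lerD (lexx _) hA)) hsum) _.
rewrite -/P PS; have PS0 : 0 <= P * S by rewrite mulr_ge0.
rewrite (_ : _ + _ = P * S * (2 * W + E * (m l).+1%:R +
  (rarity l.+1 l.+1).+1%:R * (W + E * (m l)%:R))); last by ring.
rewrite ler_wpM2l //.
have w1 : w l <= W' by exact: w_mono.
have w2 : (m l)%:R * w l <= 2 * W' by exact: m_le_w.
have W'0 : 0 <= W' by exact: w_ge0.
have -> : (ratio l.+1)%:R = ((rarity l.+1 l.+1).+1%:R + 2) * (l.+2%:R + 3 * (ratio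
  l)%:R) :> R.
  rewrite -[ratio l.+1]/((rarity l.+1 l.+1 + 3) * (l.+2 + 3 * ratio l))%N natrM natrD [X
    in _ * X]natrD natrM -[(rarity _ _).+1%:R]natr1; ring.
rewrite -[W]/(l.+2%:R * W') -[(m l).+1%:R]natr1.
set e' : R := (rarity _ _).+1%:R.
have e'0 : 0 <= e' by rewrite ler0n.
set r : R := (ratio l)%:R in E E0 H HA HB hA hsum *.
have r0 : 0 <= r by rewrite ler0n.
have Em : E * (m l)%:R <= 2 * (r * W').
  by rewrite /E -mulrA [w l * _]mulrC [2 * _]mulrCA ler_wpM2l.
have E1 : E <= r * W' by rewrite ler_wpM2l.
have rW0 : 0 <= r * W' by rewrite mulr_ge0.
set L : R := l.+2%:R; have LW0 : 0 <= L * W' by rewrite mulr_ge0.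
have : e' * (L * W' + E * (m l)%:R) <= e' * (L * W' + 2 * (r * W')).
  by rewrite ler_wpM2l // lerD2l.
have : 0 <= e' * (r * W') by rewrite mulr_ge0.
have : 0 <= e' * (L * W') by rewrite mulr_ge0.
move: Em E1 rW0 LW0; lra.
Qed.

Lemma expected_cost l s : \sum_(om : seeds l) run_cost w l.+1 (conf om) s <=
    #|seeds l|%:R * ((ratio l)%:R * w l) * (size (level_phases l s)).+1%:R.
Proof.
elim: l s => [|l IH]; apply: expected_cost_of_phase; first exact: expected_phase0.
exact: expected_phaseS.
Qed.

End ExpectedCost.

Local Open Scope classical_set_scope.

(** * Randomized algorithms in the sense of the model *)

Section Uniform.
Variables (R : realType) (n : nat).

Lemma weight_uniform_ge0 : 0 <= n.+1%:R^-1 :> R.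
Proof. by rewrite invr_ge0. Qed.

Definition uniform_nat : set nat -> \bar R :=
  mscale (NngNum weight_uniform_ge0) (msum (fun i => \d_i) n.+1).

HB.instance Definition _ := Measure.on uniform_nat.

Lemma uniform_nat_setT : uniform_nat setT = 1%E.
Proof.
rewrite /uniform_nat /mscale /= /msum.
rewrite (eq_bigr (fun=> 1%E)) => [|i _]; last exact: diracT.
by rewrite sumEFin -EFinM sumr_const card_ord mulVf ?pnatr_eq0.
Qed.

HB.instance Definition _ :=
  @Measure_isProbability.Build _ _ R uniform_nat uniform_nat_setT.

Lemma expectation_uniform (f : nat -> R) : (forall i, 0 <= f i) ->
  'E_uniform_nat[f]%E = (n.+1%:R^-1 * \sum_(i < n.+1) f i)%:E.
Proof.
move=> f0; rewrite unlock.
rewrite ge0_integral_mscale // => [|i _]; last by rewrite lee_fin.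
rewrite ge0_integral_measure_sum // => [|i _]; last by rewrite lee_fin.
under eq_bigr do rewrite integral_dirac // diracT mul1e.
by rewrite sumEFin EFinM.
Qed.

End Uniform.

Section Mixture.
Variables (R : realType) (k : nat) (I : instance R k) (S : finType) (s0 : S).
Variable a : S -> det_alg I.

(** Seeds are drawn as indices, because every set of natural numbers is measurable. *)
Definition mixture : rand_alg I :=
  @RandAlg R k I _ _ (uniform_nat R #|S|.-1)
    (fun i => a (nth s0 (enum S) i)) (fun _ _ _ => Logic.I) (fun _ _ _ => Logic.I).

Lemma ALG_mixture rho :
  ALG mixture rho = (#|S|%:R^-1 * \sum_(s : S) det_cost (a s) rho)%:E.
Proof.
rewrite /ALG expectation_uniform => [|i]; last exact: schedule_cost_ge0.
have S0 : (0 < #|S|)%N by apply/card_gt0P; exists s0.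
rewrite prednK // /mixture /=; congr (_ * _)%:E.
by rewrite -[RHS]big_enum [RHS](big_nth s0) -cardE big_mkord.
Qed.

End Mixture.

(** * The competitive ratio *)

Lemma ratio_gt0 l : (0 < ratio l)%N.
Proof. by case: l => //= l; rewrite muln_gt0 !addn_gt0 !orbT. Qed.

(** Passing from level l to l+1 multiplies [ratio] by at most 2^(5l+8), while the exponent on the
    right grows by 16l+24. *)
Lemma ratio_le l : (ratio l <= 2 ^ (8 * l.+1 ^ 2))%N.
Proof.
elim: l => [//|l IH].
rewrite -[ratio l.+1]/((rarity l.+1 l.+1 + 3) * (l.+2 + 3 * ratio l))%N.
have h1 : (l + 3 <= 4 ^ l.+1)%N.
  elim: (l) => // j hj; rewrite expnS addSn.
  by move: hj; generalize (4 ^ j.+1)%N => x; lia.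
have h2 : (l + 5 <= 2 ^ (l + 3))%N.
  elim: (l) => // j hj; rewrite !addSn [(2 ^ _)%N]expnS.
  by move: hj; generalize (2 ^ (j + 3))%N => x; lia.
have h3 : (rarity l.+1 l.+1 + 3 <= 2 ^ (4 * l + 5))%N.
  have hr := rarity_le l.+1 l.+1.
  have h5 : (4 ^ l.+1 * (l.+1 + 2) <= 2 ^ (4 * l + 4))%N.
    have -> : (2 ^ (4 * l + 4) = 4 ^ l.+1 * 4 ^ l.+1)%N.
      by rewrite -expnD -(expnM 2 2); congr (2 ^ _)%N; lia.
    by rewrite leq_mul2l addSn -addnS h1 orbT.
  have h6 : (2 ^ 2 <= 2 ^ (4 * l + 4))%N by rewrite leq_exp2l //; lia.
  rewrite [(4 * l + 5)%N]addnS expnS; move: (leq_trans hr h5) h6.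
  by generalize (2 ^ (4 * l + 4))%N => x; lia.
have h4 : (l.+2 + 3 * ratio l <= (l + 5) * ratio l)%N by have := ratio_gt0 l; nia.
apply: leq_trans (leq_mul h3 (leq_trans h4 (leq_mul h2 IH))) _.
by rewrite -!expnD leq_exp2l //; nia.
Qed.

Lemma exp2_le_expR (R : realType) n : 2 ^+ n <= expR n%:R :> R.
Proof.
rewrite -[n%:R]mulr1 expRM_natl lerXn2r ?nnegrE ?expR_ge0 //.
by have := expR_ge1Dx (1 : R); lra.
Qed.

Section Competitive.
Variables (R : realType) (l : nat) (I : instance R l.+1).

(* The last weight is repeated forever, which makes the levels uniform. *)
Definition ext_weight (i : nat) : R := weight I (inord (minn i l)).
Local Notation w := ext_weight.
Let W : R := \sum_(j < l.+1) weight I j.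

Lemma ext_weightE (j : 'I_l.+1) : w j = weight I j.
Proof. by rewrite /ext_weight (minn_idPl (leq_ord j)) inord_val. Qed.

Lemma ext_weight_ge0 i : 0 <= w i.
Proof. exact: weight_ge0. Qed.

Lemma ext_weight_mono i : w i <= w i.+1.
Proof. by apply: weight_sorted; rewrite !inordK ?ltnS ?geq_minr //; lia. Qed.

Lemma move_costE (p q : config I) (c c' : nat -> pts I) :
  (forall j : 'I_l.+1, p j = c j) -> (forall j : 'I_l.+1, q j = c' j) ->
  move_cost p q = move w l.+1 c c'.
Proof. by move=> hp hq; apply: eq_bigr => j _; rewrite ext_weightE hp hq. Qed.

Lemma move_cost_le (p q : config I) : move_cost p q <= W.
Proof.
by apply: ler_sum => j _; case: (_ != _); rewrite ?mulr1 ?mulr0 ?weight_ge0.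
Qed.

Lemma total_weight_ge0 : 0 <= W.
Proof. by apply: sumr_ge0 => j _; exact: weight_ge0. Qed.

Section Algorithm.
Variable F : seq (pts I) -> nat -> pts I.
Hypothesis F_serves : forall s r, has (fun i => F (rcons s r) i == r) (iota 0 l.+1).

Definition run_of rho : config I := if rho is [::] then init I else [ffun j => F rho
  (val j)].

Lemma run_of_rcons rho r : exists j : 'I_l.+1, run_of (rcons rho r) j = r.
Proof.
have /hasP[i] := F_serves rho r; rewrite mem_iota => /andP[_ il] /eqP e.
by exists (Ordinal il); case: rho e => [|a rho] e; rewrite /run_of /= ffunE.
Qed.

Definition alg_of : det_alg I := @DetAlg _ _ _ run_of erefl run_of_rcons.

(** The term [W] pays for the first step, which starts from [init I] instead of [F [::]]. *)
Lemma det_cost_alg_of (rho : seq (pts I)) : det_cost alg_of rho <= W + run_cost w l.+1 F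
  rho.
Proof.
rewrite /det_cost /schedule_cost /run_cost.
case E : (size rho) => [|n]; first by rewrite !big_ord0 addr0 total_weight_ge0.
rewrite !big_ord_recl lerD ?move_cost_le //.
apply: le_trans (_ : \sum_(i < n) move w l.+1 (F (take (bump 0 i) rho)) (F (take (bump 0
  i).+1 rho)) <= _).
  rewrite le_eqVlt; apply/orP; left; apply/eqP; apply: eq_bigr => i _.
  by apply: move_costE => j; rewrite /= /run_of; case: rho E => //= a rho _;
    rewrite ffunE.
by rewrite lerDr move_ge0 //; exact: ext_weight_ge0.
Qed.

End Algorithm.

Lemma cost_schedule (g : nat -> nat -> pts I) (h : nat -> pts I) a n :
  cost_from w l.+1 (g a) [seq (h t, g t.+1) | t <- iota a n] =
  \sum_(i < n) move w l.+1 (g (a + i)%N) (g (a + i).+1).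
Proof.
elim: n a => [|n IH] a; first by rewrite big_ord0.
rewrite big_ord_recl /= addn0 IH; congr (_ + _).
by apply: eq_bigr => i _; rewrite /bump /= add1n addnS.
Qed.

Variable m : nat -> nat.
Hypothesis m_gt0 : forall i, (0 < m i)%N.
Hypothesis w_le_m : forall i, w i.+1 <= (m i)%:R * w i.

Lemma phases_le_OPT (rho : seq (pts I)) :
  w l * beta R l * (size (level_phases R m l rho))%:R <= OPT rho.
Proof.
have [s [s0 hs] <-] := OPT_attained rho (ltn0Sn l).
pose g t (i : nat) := s t (inord i); set n := size rho.
pose h t := nth (init I ord0) rho t.
pose z := [seq (h t, g t.+1) | t <- iota 0 n].
have zE : map fst z = rho.
  by rewrite -map_comp -[RHS](mkseq_nth (init I ord0)).
have sz : all (served l.+1 [::]) z.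
  rewrite all_map; apply/allP => t; rewrite mem_iota => /andP[_ tn] /=.
  have [j ej] := hs (Ordinal tn); apply/hasP; exists (val j);
    first by rewrite mem_iota /=.
  rewrite /= /g inord_val; apply/eqP.
  by apply: etrans ej _; rewrite (tnth_nth (init I ord0)).
rewrite -[in X in X <= _]zE;
  apply: le_trans (phases_le_cost ext_weight_ge0 m_gt0 w_le_m sz) _.
apply: le_trans (cost_le_from ext_weight_ge0 _ (g 0%N) _) _.
rewrite cost_schedule le_eqVlt; apply/orP; left; apply/eqP.
by apply: eq_bigr => i _; apply/esym/move_costE => j; rewrite /g inord_val.
Qed.

Hypothesis m_le_w : forall i, (m i)%:R * w i <= 2 * w i.+1.

Definition server_alg (om : seeds l) : det_alg I :=
  alg_of (conf_serves R m (init I ord0) om).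

Lemma card_seeds : (0 < #|seeds l|)%N.
Proof.
elim: (l) => [|j IH] /=; first by rewrite card_unit.
by rewrite card_prod muln_gt0 IH; apply/card_gt0P; exists 1%g.
Qed.

(** A phase costs the algorithm [ratio l * w l] on average and [OPT] at least [w l * beta l]; the
    quotient is [ratio l * 2 ^ l]. The unfinished phase goes to the additive constant. *)
Lemma average_det_cost (rho : seq (pts I)) :
  #|seeds l|%:R^-1 * \sum_(om : seeds l) det_cost (server_alg om) rho <=
  (2 ^ (8 * l.+1 ^ 2 + l))%:R * OPT rho + (W + (ratio l)%:R * w l).
Proof.
have N0 : 0 < #|seeds l|%:R :> R by rewrite ltr0n card_seeds.
rewrite ler_pdivrMl //; set N : R := #|seeds l|%:R in N0 *.
apply: le_trans (ler_sum _ (fun om _ => det_cost_alg_of _ rho)) _.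
rewrite big_split /= sumr_const -[_ *+ _]mulr_natl -/N.
apply: le_trans (lerD (lexx _) (expected_cost (init I ord0) m_gt0 ext_weight_ge0
  ext_weight_mono m_le_w l rho)) _.
rewrite -/N -natr1; set s : R := (size _)%:R.
rewrite -mulrA -mulrDr ler_wpM2l ?(ltW N0) // addrCA lerD2l mulrDr mulr1 lerD2r.
have hO := phases_le_OPT rho; rewrite -/s in hO.
apply: le_trans (_ : (ratio l)%:R * 2 ^+ l * OPT rho <= _); last first.
  rewrite ler_wpM2r //; last by rewrite natrX exprD ler_wpM2r // -natrX ler_nat ratio_le.
  by apply: le_trans hO; rewrite !mulr_ge0 ?ext_weight_ge0 // ltW // beta_gt0.
rewrite -!mulrA ler_wpM2l //.
have hb : 2 ^+ l * beta R l = 1.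
  by rewrite /beta exprVn divff // expf_neq0 // pnatr_eq0.
have -> : w l * s = 2 ^+ l * (w l * beta R l * s).
  by rewrite -[LHS]mul1r -[X in X * _ = _]hb; ring.
by rewrite ler_wpM2l // exprn_ge0.
Qed.

End Competitive.

Lemma zero_weight_alg (R : realType) (l : nat) (I : instance R l.+1) :
  weight I ord0 = 0 -> exists a : det_alg I, forall rho,
    det_cost a rho <= \sum_(j < l.+1) weight I j.
Proof.
move=> w0; pose F s i := if i == 0%N then last (init I ord0) s else init I (inord i).
have F_serves s r : has (fun i => F (rcons s r) i == r) (iota 0 l.+1).
  by rewrite /= /F /= last_rcons eqxx.
exists (alg_of F_serves) => rho.
apply: le_trans (det_cost_alg_of F_serves rho) _.
rewrite (_ : run_cost _ _ _ _ = 0) ?addr0 //; apply: big1 => i _; apply: big1 => j _.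
rewrite /F.
have [j0|_] := eqVneq (nat_of_ord j) 0%N; last by rewrite eqxx mulr0.
by rewrite ext_weightE (_ : j = ord0) ?w0 ?mul0r //; exact: val_inj.
Qed.

Lemma instance_alg (R : realType) (l : nat) (I : instance R l.+1) :
  exists A : rand_alg I, exists c', forall rho,
    (ALG A rho <= ((2 ^ (8 * l.+1 ^ 2 + l))%:R * OPT rho + c')%:E)%E.
Proof.
have OPT0 (rho : seq (pts I)) : 0 <= OPT rho.
  have [s _ <-] := OPT_attained rho (ltn0Sn l); exact: schedule_cost_ge0.
have [w0|w0] := eqVneq (weight I ord0) 0.
  have [a ha] := zero_weight_alg w0.
  exists (mixture tt (fun=> a)), (\sum_(j < l.+1) weight I j) => rho.
  rewrite ALG_mixture card_unit invr1 mul1r big_const card_unit /= addr0 lee_fin.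
  by apply: le_trans (ha rho) _; rewrite lerDr mulr_ge0.
have w_gt0 i : 0 < ext_weight I i.
  apply: lt_le_trans (_ : weight I ord0 <= _); first by rewrite lt0r w0 weight_ge0.
  by apply: weight_sorted; rewrite leq0n.
(* [m i] exceeds the quotient of the weights by at most 1, and this quotient is at least 1 as the
   weights are sorted; hence the factor 2 in [m_le_w]. *)
pose m i := (Num.truncn (ext_weight I i.+1 / ext_weight I i)).+1.
have w_le_m i : ext_weight I i.+1 <= (m i)%:R * ext_weight I i.
  by rewrite -ler_pdivrMr // ltW // truncnS_gt.
have m_le_w i : (m i)%:R * ext_weight I i <= 2 * ext_weight I i.+1.
  rewrite /m -natr1 mulrDl mul1r mulr2n mulrDl mul1r lerD ?ext_weight_mono //.
  by rewrite -ler_pdivlMr // truncn_le divr_ge0 // ltW.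
have [om0 _] : exists om0 : seeds l, om0 \in seeds l.
  by apply/card_gt0P; exact: card_seeds.
exists (mixture om0 (server_alg I m)); eexists => rho.
by rewrite ALG_mixture lee_fin; exact: (average_det_cost (m := m)).
Qed.

Theorem theorem1 (R : realType) :
  exists f : nat -> R,
    f =O_\oo (fun k : nat => k%:R ^+ 2 : R) /\
    forall k : nat, (1 <= k)%N ->
      exists A : forall I : instance R k, rand_alg I, competitive A (expR (f k)).
Proof.
(* For k = l+1 the exponent 8 k^2 + l is at most 9 k^2, and 2 is at most the base of [expR]. *)
exists (fun k => (9 * k ^ 2)%:R); split.
  apply/eqO_exP; exists 9 => //; near=> k.
  by rewrite natrM natrX normrM ger0_norm.
case=> // l _.
exists (fun I => projT1 (cid (instance_alg I))) => I.
have [c' hc'] := projT2 (cid (instance_alg I)).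
exists c' => rho; apply: le_trans (hc' rho) _.
rewrite lee_fin lerD2r ler_wpM2r //.
  have [s _ <-] := OPT_attained rho (ltn0Sn l); exact: schedule_cost_ge0.
apply: le_trans (exp2_le_expR _ _); rewrite natrX ler_eXn2l ?ltr1n //.
by nia.
Unshelve. all: by end_near.
Qed.
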